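(* Let $d\ge2$. For any $\nu\in(0,1]$ and $\epsilon\in(0,1)$ there exists $\delta_1>0$ depending only on $d,\epsilon,\nu$ such that if a domain $\Omega\subset\mathbb R^d$ satisfies $\langle\mathrm{TER}\rangle_{\delta_1}$, then there is a measurable function $\phi:\Omega\to\mathbb R$ such that: (1) for every $(\alpha^{ij})\in\mathrm M(\nu^2,1)$, $\sum_{i,j}\alpha^{ij}D_{ij}\phi\le0$ in the sense of distributions on $\Omega$; (2) there exists $N=N(d,\nu,\epsilon,R_{0,\delta_1}/R_{\infty,\delta_1})>0$ with $N^{-1}\rho(x)^{1-\epsilon}\le\phi(x)\le N\rho(x)^{1-\epsilon}$ for all $x\in\Omega$.
   Context: $\rho(x)=\mathrm{dist}(x,\partial\Omega)$. $\mathrm M(\nu_1,\nu_2)$: real symmetric $d\times d$ matrices with $\nu_1|\xi|^2\le\sum\alpha^{ij}\xi_i\xi_j\le\nu_2|\xi|^2$. $\mathbf{ER}_\Omega$ is the set of $(\delta,R)\in[0,1]\times(0,\infty)$ such that for each $p\in\partial\Omega$ and each connected component $\Omega^{(i)}_{p,R}$ of $\Omega\cap B(p,R)$ there is a unit vector $e^{(i)}_{p,R}$ with $\Omega^{(i)}_{p,R}\subset\{x\in B_R(p):(x-p)\cdot e^{(i)}_{p,R}<\delta R\}$; $\delta_\Omega(R)$ is the infimum of $\delta$ with $(\delta,R)\in\mathbf{ER}_\Omega$. For $\delta\in[0,1]$, $\Omega$ satisfies $\langle\mathrm{TER}\rangle_\delta$ if there exist $0<R_{0,\delta}\le R_{\infty,\delta}<\infty$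 with $\delta_\Omega(R)\le\delta$ whenever $R\le R_{0,\delta}$ or $R\ge R_{\infty,\delta}$. *)

(* Defs.v *)
From HB Require Import structures.
From mathcomp Require Import all_boot all_order all_algebra.
From mathcomp Require Import all_classical all_reals all_analysis.
Set Implicit Arguments. Unset Strict Implicit. Unset Printing Implicit Defensive.
Import Order.TTheory GRing.Theory Num.Theory.
Import numFieldNormedType.Exports.
Local Open Scope classical_set_scope.
Local Open Scope ring_scope.

Section Defs.
Variables (R : realType) (d : nat).
Notation V := 'rV[R]_d.

(* Euclidean structure on R^d = 'rV[R]_d (the library norm on 'rV is the sup
   norm, which induces the same topology, but balls/distances below must be
   Euclidean). *)
Definition dotv (x y : V) : R := \sum_(i < d) x ord0 i * y ord0 i.
Definition enorm (x : V) : R := Num.sqrt (dotv x x).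
Definition eball (p : V) (r : R) : set V := [set x | enorm (x - p) < r].

Definition bdry (Om : set V) : set V := closure Om `\` interior Om.

Definition rho (Om : set V) (x : V) : R := inf [set enorm (x - p) | p in bdry Om].

Definition is_domain (Om : set V) : Prop := open Om /\ connected Om /\ Om !=set0.

Definition ER (Om : set V) (delta r : R) : Prop :=
  0 <= delta <= 1 /\ 0 < r /\
  forall p, bdry Om p ->
  forall x, (Om `&` eball p r) x ->
  exists e : V, enorm e = 1 /\
    connected_component (Om `&` eball p r) x
      `<=` [set y | eball p r y /\ dotv (y - p) e < delta * r].

Definition delta_Om (Om : set V) (r : R) : R := inf [set delta | ER Om delta r].

Definition TER_with (Om : set V) (delta R0 Rinf : R) : Prop :=
  0 < R0 /\ R0 <= Rinf /\
  forall r, 0 < r -> (r <= R0 \/ Rinf <= r) -> delta_Om Om r <= delta.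

Definition in_M (nu1 nu2 : R) (A : 'M[R]_d) : Prop :=
  A^T = A /\
  forall xi : V, nu1 * dotv xi xi <= \sum_(i < d) \sum_(j < d) A i j * xi ord0 i * xi ord0 j
                 <= nu2 * dotv xi xi.

Definition ebase (i : 'I_d) : V := delta_mx ord0 i.
Definition pD (i : 'I_d) (f : V -> R) : V -> R := 'D_(ebase i) f.
Definition iter_pD (s : seq 'I_d) (f : V -> R) : V -> R := foldr pD f s.

Definition smooth (f : V -> R) : Prop :=
  forall s : seq 'I_d, continuous (iter_pD s f) /\
    forall (i : 'I_d) x, derivable (iter_pD s f) x (ebase i).

Definition test_fun_nonneg (Om : set V) (eta : V -> R) : Prop :=
  smooth eta /\ (forall x, 0 <= eta x) /\
  exists K : set V, compact K /\ K `<=` Om /\ (forall x, ~ K x -> eta x = 0).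

(* identification of R^d with d-tuples (product sigma-algebra = Borel) *)
Definition rV_of_tuple (t : d.-tuple R) : V := \row_(i < d) tnth t i.
End Defs.

Fixpoint iint (R : realType) (n : nat) : (n.-tuple R -> R) -> R :=
  match n return (n.-tuple R -> R) -> R with
  | 0 => fun f => f [tuple]
  | n'.+1 => fun f =>
      Rintegral (@lebesgue_measure R) setT
        (fun t => iint (fun x : n'.-tuple R => f (cons_tuple t x)))
  end.

Definition integral_Rd (R : realType) (d : nat) (f : 'rV[R]_d -> R) : R :=
  iint (fun t => f (rV_of_tuple t)).

Definition measurable_on (R : realType) (d : nat) (Om : set 'rV[R]_d)
    (phi : 'rV[R]_d -> R) : Prop :=
  measurable_fun (@rV_of_tuple R d @^-1` Om) (phi \o @rV_of_tuple R d).

Definition distr_nonpos (R : realType) (d : nat) (Om : set 'rV[R]_d)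
    (A : 'M[R]_d) (phi : 'rV[R]_d -> R) : Prop :=
  forall eta, test_fun_nonneg Om eta ->
    integral_Rd (fun x => if x \in Om then
        phi x * \sum_(i < d) \sum_(j < d) A i j * pD i (pD j eta) x else 0) <= 0.

(* Main.v *)
(* Near a boundary point p, at an allowed scale r, each component of the domain
   inside B(p, r) lies below a hyperplane at height theta r. With z = (x - p) / r
   and s the distance of z to that hyperplane, the quadratic polynomial
   q = 2 K s - K s^2 + |z|^2 is nonnegative there and satisfies
   sum a_ij D_ij q <= 0 for every admissible matrix as soon as K >= d / nu^2. It is
   at least 1/4 for |z| >= 1/2, whereas q + theta is O(theta) for |z| <= theta. The
   function phi is the infimum of r^(1-eps) (q + theta) over all such balls
   containing x, with a larger constant factor at the scales r <= R0. Since
   theta^eps is small, a member of the family is beaten in the outer half of its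
   ball by the one in the ball of radius r / theta (or Rinf), so near x only
   members defined on a full neighbourhood of x matter. Writing the matrix as a sum
   of v v^T, the sum of the second differences of phi along the vectors v is
   therefore nonpositive for small steps (second differences of quadratic
   polynomials are exact). Moving these differences onto the test function by
   translation invariance and letting the step tend to 0 gives the inequality in
   the sense of distributions. *)
Require Import Defs.
From HB Require Import structures.
From mathcomp Require Import all_boot all_order all_algebra.
From mathcomp Require Import all_classical all_reals all_analysis.
From mathcomp Require Import measurable_realfun ring lra.
Set Implicit Arguments. Unset Strict Implicit. Unset Printing Implicit Defensive.
Import Order.TTheory GRing.Theory Num.Theory.
Import numFieldNormedType.Exports.
Local Open Scope classical_set_scope.
Local Open Scope ring_scope.

(** * Iterated integrals *)

Section IteratedIntegral.
Variable R : realType.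
Local Notation mu := (@lebesgue_measure R).

(** [Rintegral] is the finite part of the integral of the positive part minus that of the negative
    part; Tonelli makes both measurable in the parameter. *)
Lemma measurable_Rintegral d (T : measurableType d) (g : T -> R -> R) :
  measurable_fun [set: T * measurableTypeR R] (fun z => g z.1 z.2) ->
  measurable_fun setT (fun t => Rintegral mu setT (g t)).
Proof.
move=> mg.
have mg' : measurable_fun [set: T * measurableTypeR R]
    (EFin \o (fun z : T * measurableTypeR R => g z.1 z.2)).
  exact/measurable_EFinP.
have -> : (fun t => Rintegral mu setT (g t)) = fine \o (fun t => \int[mu]_x (g t x)%:E)%E.
  exact/funext.
apply: measurableT_comp; first exact: fine_measurable.
under eq_fun do rewrite integralE.
apply: emeasurable_funB.
- have := measurable_fun_fubini_tonelli_F (m2 := mu) _ (measurable_funepos mg') (funepos_ge0 _).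
  apply: eq_measurable_fun => t _; apply: eq_integral => x _.
  by rewrite !funeposE.
- have := measurable_fun_fubini_tonelli_F (m2 := mu) _ (measurable_funeneg mg') (funeneg_ge0 _).
  apply: eq_measurable_fun => t _; apply: eq_integral => x _.
  by rewrite !funenegE.
Qed.

(** The parameter space is arbitrary so that the induction can absorb the outermost integration
    variable into it. *)
Lemma measurable_iint n : forall d (T : measurableType d) (f : T -> n.-tuple R -> R),
  measurable_fun [set: T * n.-tuple R] (fun z => f z.1 z.2) ->
  measurable_fun setT (fun t => iint (f t)).
Proof.
elim: n => [|n IHn] d T f mf /=.
  have -> : (fun t => f t [tuple]) = (fun z => f z.1 z.2) \o (fun t => (t, [tuple] : 0.-tuple R)).
    exact/funext.
  apply: measurableT_comp => //.
apply: (measurable_Rintegral (g := fun t s => iint (fun x : n.-tuple R => f t (cons_tuple s x)))).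
apply: (IHn _ (T * measurableTypeR R)%type (fun z x => f z.1 (cons_tuple z.2 x))).
have -> : (fun z : (T * measurableTypeR R) * n.-tuple R => f z.1.1 (cons_tuple z.1.2 z.2)) =
   (fun z => f z.1 z.2) \o (fun z => (z.1.1, cons_tuple z.1.2 z.2)) by exact/funext.
apply: measurableT_comp => //.
apply: measurable_fun_pair.
  exact: (measurableT_comp measurable_fst measurable_fst).
apply: (@measurable_cons _ _ _ _ _ n).
  exact: (measurableT_comp measurable_snd measurable_fst).
exact: measurable_snd.
Qed.

(** One constant bounds both the values and the support. The class passes to slices, sums and
    multiples, and on it every integral of the iteration is that of an integrable function. *)
Definition bounded_box_supported n (f : n.-tuple R -> R) : Prop :=
  measurable_fun setT f /\
  exists M, forall t, `|f t| <= M /\ ((exists i, M < `|tnth t i|) -> f t = 0).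

Lemma bbs_section n (f : n.+1.-tuple R -> R) (s : R) :
  bounded_box_supported f -> bounded_box_supported (fun x => f (cons_tuple s x)).
Proof.
move=> [mf [M fM]]; split.
  have -> : (fun x => f (cons_tuple s x)) = f \o (fun x => cons_tuple s x) by exact/funext.
  apply: measurableT_comp => //.
  by apply: (@measurable_cons _ _ _ _ (cst s) n id).
exists M => t; have [? f0] := fM (cons_tuple s t); split=> // -[i Mi].
by apply: f0; exists (lift ord0 i); rewrite tnthS.
Qed.

Lemma integrable_bounded_supported (g : R -> R) (M : R) :
  measurable_fun [set: measurableTypeR R] g ->
  (forall t, `|g t| <= M) -> (forall t, M < `|t| -> g t = 0) ->
  mu.-integrable setT (EFin \o g).
Proof.
move=> mg gM g0.
have -> : g = g \_ `[-M, M].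
  apply/funext => t; rewrite patchE; case: ifPn => // /negP tM.
  apply: g0; rewrite ltNge; apply/negP => h; apply: tM.
  by rewrite inE /= in_itv /= -ler_norml.
rewrite -restrict_EFin -integrable_mkcond//.
apply: measurable_bounded_integrable => //.
- by rewrite /= lebesgue_measure_itv/=; case: ifP => _; rewrite -?EFinB ltry.
- exact: measurable_funTS.
- by exists M; split; [exact: num_real|move=> x Mx t _; exact: le_trans (gM t) (ltW Mx)].
Qed.

(** The uniform bound in [n] variables is a hypothesis, so that the lemma serves both inside the
    induction establishing that bound and after it. *)
Lemma iint_slice_integrable n (f : n.+1.-tuple R -> R) : bounded_box_supported f ->
  (forall M, exists C, forall g : n.-tuple R -> R, bounded_box_supported g ->
     (forall t, `|g t| <= M /\ ((exists i, M < `|tnth t i|) -> g t = 0)) ->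
     `|iint g| <= C) ->
  iint (fun _ : n.-tuple R => 0) = 0 ->
  mu.-integrable setT (EFin \o (fun s => iint (fun x : n.-tuple R => f (cons_tuple s x)))).
Proof.
move=> bf; have [mf [M fM]] := bf => /(_ M)[C HC] i0.
apply: (@integrable_bounded_supported _ (Num.max C M)).
- apply: (@measurable_iint _ _ (measurableTypeR R) (fun s x => f (cons_tuple s x))).
  have -> : (fun z : (measurableTypeR R) * n.-tuple R => f (cons_tuple z.1 z.2)) =
     f \o (fun z => cons_tuple z.1 z.2) by exact/funext.
  apply: measurableT_comp => //.
  exact: (@measurable_cons _ _ _ _ fst n snd).
- move=> t; apply: (@le_trans _ _ C); last by rewrite le_max lexx.
  apply: HC; first exact: bbs_section.
  move=> x; have [? f0] := fM (cons_tuple t x); split=> // -[i Mi].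
  by apply: f0; exists (lift ord0 i); rewrite tnthS.
- move=> t; rewrite gt_max => /andP[_ Mt].
  rewrite -[RHS]i0; congr iint; apply/funext => x.
  by have [_] := fM (cons_tuple t x); apply; exists ord0.
Qed.

Lemma iint0 n : iint (fun _ : n.-tuple R => 0) = 0.
Proof. by elim: n => //= n ->; rewrite Rintegral_cst// mul0r. Qed.

(* Slice integrals are integrable because they are bounded, so the bound is
   carried along in the induction. *)
Lemma iint_le_bounded n :
  (forall f g : n.-tuple R -> R, bounded_box_supported f -> bounded_box_supported g ->
     (forall t, f t <= g t) -> iint f <= iint g) /\
  (forall M, exists C, forall g : n.-tuple R -> R, bounded_box_supported g ->
     (forall t, `|g t| <= M /\ ((exists i, M < `|tnth t i|) -> g t = 0)) ->
     `|iint g| <= C).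
Proof.
elim: n => [|n [IHle IHb]].
  split=> [f g _ _|M]; first exact.
  by exists M => g _ gM; exact: (gM _).1.
have HI f : bounded_box_supported f -> 
  mu.-integrable setT (EFin \o (fun s => iint (fun x : n.-tuple R => f (cons_tuple s x)))).
  by move=> bf; apply: iint_slice_integrable => //; exact: iint0.
split=> [f g bf bg fg|M] /=.
  apply: le_Rintegral => //; [exact: HI|exact: HI|].
  by move=> s _; apply: IHle => //; exact: bbs_section.
have [C HC] := IHb M.
(* Slices at [s] outside [-M, M] vanish and the others have integral at most [C], so the integral of
   [C] over [-M, M] is a bound. *)
exists (Rintegral mu setT ((cst C) \_ `[-M, M])) => g bg gM.
have iC : mu.-integrable setT (EFin \o ((cst C) \_ `[-M, M])).
  rewrite -restrict_EFin -integrable_mkcond//.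
  apply: measurable_bounded_integrable => //.
  - by rewrite /= lebesgue_measure_itv/=; case: ifP => _; rewrite -?EFinB ltry.
  - by exists `|C|; split; [exact: num_real|move=> x Mx t _; exact: (ltW Mx)].
apply: le_trans (le_normr_Rintegral _ (HI _ bg)) _ => //.
apply: le_Rintegral => //.
  exact: (integrable_norm (HI _ bg)).
move=> s _; case: ifPn => sM.
  apply: HC; first exact: bbs_section.
  move=> x; have [? f0] := gM (cons_tuple s x); split=> // -[i Mi].
  by apply: f0; exists (lift ord0 i); rewrite tnthS.
rewrite (_ : (fun x => g (cons_tuple s x)) = fun=> 0) ?iint0 ?normr0//.
apply/funext => x; apply: (gM _).2; exists ord0.
rewrite ltNge; apply/negP => h; move/negP: sM; apply.
by rewrite inE /= in_itv /= -ler_norml.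
Qed.

Lemma iint_le n (f g : n.-tuple R -> R) :
  bounded_box_supported f -> bounded_box_supported g ->
  (forall t, f t <= g t) -> iint f <= iint g.
Proof. exact: (iint_le_bounded n).1. Qed.

Lemma integrable_iint_slice n (f : n.+1.-tuple R -> R) : bounded_box_supported f ->
  mu.-integrable setT (EFin \o (fun s => iint (fun x : n.-tuple R => f (cons_tuple s x)))).
Proof.
by move=> bf; apply: iint_slice_integrable => //; [exact: (iint_le_bounded n).2|exact: iint0].
Qed.

Lemma bbsD n (f g : n.-tuple R -> R) :
  bounded_box_supported f -> bounded_box_supported g ->
  bounded_box_supported (fun t => f t + g t).
Proof.
move=> [mf [M fM]] [mg [N gN]]; split; first exact: measurable_funD.
exists (`|M| + `|N|) => t; have [fM1 fM2] := fM t; have [gN1 gN2] := gN t.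
have := ler_norm M; have := ler_norm N => NN MM.
have := normr_ge0 M; have := normr_ge0 N => N0 M0.
split; first by apply: le_trans (ler_normD _ _) _; lra.
move=> [i Hi]; rewrite fM2 ?gN2 ?addr0//; exists i; lra.
Qed.

Lemma bbsZ n (c : R) (f : n.-tuple R -> R) :
  bounded_box_supported f -> bounded_box_supported (fun t => c * f t).
Proof.
move=> [mf [M fM]]; split; first exact: measurable_funM.
exists ((`|c| + 1) * `|M|) => t; have [fM1 fM2] := fM t.
have := ler_norm M; have := normr_ge0 M; have := normr_ge0 c => c0 M0 MM.
have cM : 0 <= `|c| * `|M| by exact: mulr_ge0.
split.
  rewrite normrM; apply: (@le_trans _ _ (`|c| * `|M|)); last lra.
  by rewrite ler_wpM2l//; lra.
move=> [i Hi]; rewrite fM2 ?mulr0//; exists i; lra.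
Qed.

Lemma iintD n (f g : n.-tuple R -> R) :
  bounded_box_supported f -> bounded_box_supported g ->
  iint (fun t => f t + g t) = iint f + iint g.
Proof.
elim: n f g => //= n IHn f g bf bg.
rewrite -RintegralD//; try exact: integrable_iint_slice.
by apply: eq_Rintegral => s _; rewrite IHn//; exact: bbs_section.
Qed.

Lemma iintZ n (c : R) (f : n.-tuple R -> R) :
  bounded_box_supported f -> iint (fun t => c * f t) = c * iint f.
Proof.
elim: n f => //= n IHn f bf.
rewrite -RintegralZl//; try exact: integrable_iint_slice.
by apply: eq_Rintegral => s _; rewrite IHn//; exact: bbs_section.
Qed.

(** * Translation invariance of the iterated integral *)

Lemma lebesgue_measure_shift (a : R) (A : set R) : measurable A ->
  pushforward mu ((fun x => x + a) : measurableTypeR R -> measurableTypeR R) A = mu A.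
Proof.
have ms : measurable_fun setT ((fun x => x + a) : measurableTypeR R -> measurableTypeR R).
  exact: measurable_funD.
move=> mA; apply/esym/lebesgue_measure_unique => //= _ [[b c]] _ <-.
rewrite /pushforward.
have -> : (fun x => x + a) @^-1` `]b, c] = `]b - a, c - a]%classic.
  by apply/funext => x /=; rewrite !in_itv/= ltrBlDr lerBrDr.
rewrite !lebesgue_measure_itv/= !lte_fin ltrBlDr subrK; case: ifP => // _.
by rewrite -!EFinB; congr EFin; ring.
Qed.

(** The change of variables is made on positive and negative parts, through the push-forward of
    Lebesgue measure, which is Lebesgue measure by uniqueness. *)
Lemma Rintegral_shift (a : R) (f : R -> R) :
  measurable_fun [set: measurableTypeR R] f ->
  Rintegral mu setT (fun x => f (x + a)) = Rintegral mu setT f.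
Proof.
move=> mf.
have ms : measurable_fun setT ((fun x => x + a) : measurableTypeR R -> measurableTypeR R).
  exact: measurable_funD.
have ge0_shift (g : R -> \bar R) : measurable_fun [set: measurableTypeR R] g ->
    (forall x, 0 <= g x)%E ->
    (\int[mu]_x g (x + a)%R = \int[mu]_x g x)%E.
  move=> mg g0; transitivity
    (\int[pushforward mu ((fun x => (x + a)%R) : measurableTypeR R -> measurableTypeR R)]_x g x)%E.
    by rewrite ge0_integral_pushforward.
  by apply: eq_measure_integral => //= A mA _; exact: lebesgue_measure_shift.
have mfE : measurable_fun [set: measurableTypeR R] (EFin \o f) by exact/measurable_EFinP.
congr fine; rewrite integralE [RHS]integralE; congr (_ - _)%E.
- rewrite -(ge0_shift (EFin \o f)^\+%E (measurable_funepos mfE) (funepos_ge0 _)).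
  by apply: eq_integral => x _; rewrite !funeposE.
- rewrite -(ge0_shift (EFin \o f)^\-%E (measurable_funeneg mfE) (funeneg_ge0 _)).
  by apply: eq_integral => x _; rewrite !funenegE.
Qed.

Definition tshift n (a t : n.-tuple R) : n.-tuple R := [tuple tnth t i + tnth a i | i < n].

Lemma measurable_tshift n (a : n.-tuple R) : measurable_fun setT (tshift a).
Proof.
apply/measurable_fun_tnthP => i.
have -> : (@tnth n R)^~ i \o tshift a = fun t => tnth t i + tnth a i.
  by apply/funext => t /=; rewrite tnth_mktuple.
by apply: measurable_funD => //; exact: measurable_tnth.
Qed.

Lemma iint_shift n (f : n.-tuple R -> R) (a : n.-tuple R) :
  bounded_box_supported f -> iint (f \o tshift a) = iint f.
Proof.
elim: n f a => [|n IHn] f a bf /=.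
  by rewrite (tuple0 (tshift _ _)).
(* The outer variable is translated by the first coordinate of [a], the inner ones by the remaining
   coordinates through the induction hypothesis. *)
rewrite -[RHS](Rintegral_shift (tnth a ord0)); last first.
  have /integrableP[+ _] := integrable_iint_slice bf.
  by move/measurable_EFinP.
apply: eq_Rintegral => s _.
rewrite -[RHS](IHn _ (behead_tuple a)); last exact: bbs_section.
congr iint; apply/funext => x /=; congr f; apply: eq_from_tnth => i.
rewrite tnth_mktuple; case: (unliftP ord0 i) => [j ->|->] //.
rewrite !tnthS tnth_mktuple tnth_behead; congr (_ + tnth a _).
by apply: val_inj; rewrite /= inordK// ltnS.
Qed.

End IteratedIntegral.

(** * Second differences and second derivatives *)

Section SecondDifferences.
Variables (R : realType) (d : nat).
Local Notation V := 'rV[R]_d.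

(** The derivative is bounded only at distance at most |a| from 0, so that estimates of Taylor
    remainders can be integrated repeatedly. *)
Lemma mvt_bound (g g' : R -> R) (B a : R) :
  (forall t, is_derive t (1 : R) g (g' t)) -> (forall t, `|t| <= `|a| -> `|g' t| <= B) ->
  `|g a - g 0| <= B * `|a|.
Proof.
move=> dg g'B.
have cg : continuous g by move=> t; apply/differentiable_continuous/derivable1_diffP; exact: ex_derive.
have [a0|a0] := leP 0 a.
  have [c] := MVT_segment a0 (fun t _ => dg t) (continuous_subspaceT cg).
  rewrite in_itv/= => /andP[c0 ca] ->.
  by rewrite subr0 normrM ler_wpM2r// g'B// ger0_norm// ger0_norm.
have [c] := MVT_segment (ltW a0) (fun t _ => dg t) (continuous_subspaceT cg).
rewrite in_itv/= => /andP[c0 ca] E.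
rewrite distrC E sub0r normrM normrN ler_wpM2r// g'B//.
by rewrite ler0_norm// (ltr0_norm a0) lerN2.
Qed.

Lemma is_derive_sum_mul (n : nat) (c : 'I_n -> R) (F : 'I_n -> R -> R) (dF : 'I_n -> R) (t : R) :
  (forall i, is_derive t (1 : R) (F i) (dF i)) ->
  is_derive t (1 : R) (fun r : R => \sum_i c i * F i r) (\sum_i c i * dF i).
Proof.
move=> HF; have -> : (fun r : R => \sum_i c i * F i r) = \sum_i (c i \*: F i).
  by apply/funext => r; rewrite fct_sumE.
by apply: is_derive_sum => i; exact: is_deriveZ.
Qed.

(** Three uses of the mean value bound give the second order Taylor expansion at h and at -h, each
    with error at most M h^3; the first order terms cancel in the sum. *)
Lemma second_difference_bound (g g1 g2 g3 : R -> R) (M h : R) :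
  (forall t, is_derive t (1 : R) g (g1 t)) -> (forall t, is_derive t (1 : R) g1 (g2 t)) ->
  (forall t, is_derive t (1 : R) g2 (g3 t)) -> (forall t, `|g3 t| <= M) -> 0 < h ->
  `|g h + g (- h) - 2 * g 0 - h ^+ 2 * g2 0| <= 2 * M * h ^+ 3.
Proof.
move=> d0 d1 d2 g3M h0.
have M0 : 0 <= M by apply: le_trans (g3M 0).
have k2 t : `|g2 t - g2 0| <= M * `|t| by exact: mvt_bound.
have k1 t : `|t| <= h -> `|g1 t - g1 0 - t * g2 0| <= M * h ^+ 2.
  move=> th; pose k t := g1 t - g1 0 - t * g2 0.
  have dk s : is_derive s (1 : R) k (g2 s - g2 0).
    by apply: is_derive_eq; rewrite /GRing.scale/=; ring.
  have := @mvt_bound k (fun s => g2 s - g2 0) (M * h) t dk.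
  rewrite /k subrr mul0r !subr0 => H.
  apply: le_trans (H _) _.
    move=> s st; apply: le_trans (k2 s) _; rewrite ler_wpM2l//; exact: le_trans st th.
  by rewrite expr2 mulrA ler_wpM2l// mulr_ge0// ltW.
have k0 t : `|t| <= h -> `|g t - g 0 - t * g1 0 - t ^+ 2 / 2 * g2 0| <= M * h ^+ 3.
  move=> th; pose k t := g t - g 0 - t * g1 0 - t ^+ 2 / 2 * g2 0.
  have dk s : is_derive s (1 : R) k (g1 s - g1 0 - s * g2 0).
    by apply: is_derive_eq; rewrite /GRing.scale/=; field.
  have := @mvt_bound k (fun s => g1 s - g1 0 - s * g2 0) (M * h ^+ 2) t dk.
  rewrite /k subrr mul0r expr0n/= !mul0r !subr0 => H.
  apply: le_trans (H _) _.
    by move=> s st; apply: k1; exact: le_trans st th.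
  by rewrite (exprSr h 2) mulrA ler_wpM2l// mulr_ge0// exprn_ge0// ltW.
have := k0 h; have := k0 (- h); rewrite normrN gtr0_norm// => /(_ (lexx _)) A /(_ (lexx _)) B.
have := ler_normD (g h - g 0 - h * g1 0 - h ^+ 2 / 2 * g2 0)
  (g (- h) - g 0 - (- h) * g1 0 - (- h) ^+ 2 / 2 * g2 0).
set X := (X in `|X| <= _); move=> AB.
have -> : g h + g (- h) - 2 * g 0 - h ^+ 2 * g2 0 = X by rewrite /X sqrrN; field.
lra.
Qed.

(** * Taylor expansion from partial derivatives *)

Definition norm1 (z : V) : R := \sum_i `|z ord0 i|.

Lemma norm1_ge0 z : 0 <= norm1 z. Proof. exact: sumr_ge0. Qed.

Lemma norm1Z t z : norm1 (t *: z) = `|t| * norm1 z.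
Proof. by rewrite /norm1 mulr_sumr; apply: eq_bigr => i _; rewrite mxE normrM. Qed.

Lemma ebaseE (i j : 'I_d) : @ebase R d i ord0 j = (j == i)%:R.
Proof. by rewrite mxE. Qed.

Definition has_partials (F : V -> R) (G : 'I_d -> V -> R) : Prop :=
  forall i z t, is_derive t (1 : R) (fun s : R => F (z + s *: ebase R i)) (G i (z + t *: ebase R i)).

(* Walk from 0 to y along the coordinate axes. *)
Lemma partials_growth (F : V -> R) (G : 'I_d -> V -> R) (c : R) (m : nat) :
  has_partials F G -> F 0 = 0 -> 0 <= c -> (forall i z, `|G i z| <= c * norm1 z ^+ m) ->
  forall y, `|F y| <= c * norm1 y ^+ m.+1.
Proof.
move=> dF F0 c0 GB y.
(* [P k] keeps the first [k] coordinates of [y], so consecutive points differ along one axis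
   only. *)
pose P k : V := \row_i (if (i < k)%N then y ord0 i else 0).
have Pd : P d = y by apply/rowP => i; rewrite mxE ltn_ord.
suff H k : (k <= d)%N -> `|F (P k)| <= c * norm1 y ^+ m * \sum_(i < d | (i < k)%N) `|y ord0 i|.
  have := H d (leqnn d); rewrite Pd exprSr mulrA => /le_trans; apply.
  by rewrite (eq_bigl xpredT)// => i; rewrite ltn_ord.
elim: k => [_|k IHk kd].
  rewrite big1 ?mulr0//; rewrite (_ : P 0 = 0) ?F0 ?normr0//.
  by apply/rowP => i; rewrite !mxE.
pose i0 := Ordinal kd.
have PE : P k.+1 = P k + y ord0 i0 *: ebase R i0.
  apply/rowP => i; rewrite !mxE !eqxx/= ltnS leq_eqVlt.
  have [->|ni] := eqVneq i i0; first by rewrite eqxx ltnn/= mulr1 add0r.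
  have -> : (i == k :> nat) = false by apply/negbTE; apply: contra ni => /eqP ik; apply/eqP/val_inj.
  by rewrite mulr0 addr0.
have step : `|F (P k.+1) - F (P k)| <= c * norm1 y ^+ m * `|y ord0 i0|.
  rewrite PE.
  have := @mvt_bound _ _ (c * norm1 y ^+ m) (y ord0 i0) (dF i0 (P k)).
  rewrite scale0r addr0; apply => t ty.
  apply: le_trans (GB _ _) _; rewrite ler_wpM2l//; apply: lerXn2r; rewrite ?nnegrE ?norm1_ge0//.
  (* Each coordinate on the walk is dominated by that of [y], so the bound at [y] holds all along
     it. *)
  apply: ler_sum => i _; rewrite !mxE eqxx/=.
  have [->|_] := eqVneq i i0; first by rewrite ltnn add0r mulr1.
  by rewrite mulr0 addr0; case: ifP => // _; rewrite normr0.
rewrite (bigD1 i0)//= mulrDr (eq_bigl (fun i : 'I_d => (i < k)%N)); last first.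
  move=> i /=; rewrite ltnS ltn_neqAle andbC; congr (~~ _ && _).
rewrite -(subrK (F (P k)) (F (P k.+1))) addrC.
apply: le_trans (ler_normD _ _) _; rewrite addrC lerD//; exact: IHk (ltnW kd).
Qed.

Lemma is_derive_line (f : V -> R) (x v : V) (t : R) :
  derivable f (x + t *: v) v ->
  is_derive t (1 : R) (fun s : R => f (x + s *: v)) ('D_v f (x + t *: v)).
Proof.
have E : (fun h : R => h^-1 *: (f (x + (h *: (1 : R) + t) *: v) - f (x + t *: v))) =
         (fun h : R => h^-1 *: (f (h *: v + (x + t *: v)) - f (x + t *: v))).
  apply/funext => h; congr (_ *: (f _ - _)).
  have -> : h *: (1 : R) = h by exact: mulr1.
  by rewrite scalerDl addrCA.
move=> df; apply: DeriveDef; first by rewrite /derivable E.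
by rewrite /derive E.
Qed.

(** Only partial derivatives are given. Bounded second ones make the growth of the first ones around
    [p] linear; a second walk along the axes then bounds the error of the linear approximation of
    [f] at [p] quadratically, which gives the derivative in every direction. *)
Lemma chain_rule (f : V -> R) (f1 : 'I_d -> V -> R) (f2 : 'I_d -> 'I_d -> V -> R) (M : R) :
  has_partials f f1 -> (forall i, has_partials (f1 i) (f2 i)) ->
  (forall i j z, `|f2 i j z| <= M) ->
  forall x v t, is_derive t (1 : R) (fun s : R => f (x + s *: v)) (\sum_i v ord0 i * f1 i (x + t *: v)).
Proof.
move=> df df1 f2M x v t.
wlog M0 : M f2M / 0 <= M => [H|].
  by apply: (H `|M|) => // i j z; exact: le_trans (f2M i j z) (ler_norm M).
set p := x + t *: v.
have f1B i z : `|f1 i (p + z) - f1 i p| <= M * norm1 z ^+ 1.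
  apply: (@partials_growth (fun z => f1 i (p + z) - f1 i p) (fun j z => f2 i j (p + z))) => //.
  - move=> j w s; have := df1 i j (p + w) s.
    under eq_fun do rewrite -addrA.
    rewrite -addrA => D; rewrite -[f2 _ _ _]subr0.
    exact: (is_deriveB D (is_derive_cst _ _ _)).
  - by rewrite addr0 subrr.
  - by move=> j w; rewrite expr0 mulr1.
have fB z : `|f (p + z) - f p - \sum_i z ord0 i * f1 i p| <= M * norm1 z ^+ 2.
  apply: (@partials_growth (fun z => f (p + z) - f p - \sum_i z ord0 i * f1 i p)
     (fun j z => f1 j (p + z) - f1 j p)) => //.
  - move=> j w s; have := df j (p + w) s.
    under eq_fun do rewrite -addrA.
    rewrite -addrA => D.
    have -> : (fun s0 : R => f (p + (w + s0 *: ebase R j)) - f p -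
       \sum_i (w + s0 *: ebase R j) ord0 i * f1 i p) =
       (fun s0 : R => f (p + (w + s0 *: ebase R j)) - (f p + \sum_i w ord0 i * f1 i p + s0 * f1 j p)).
      apply/funext => r; rewrite -addrA -opprD; congr (_ - _); rewrite -addrA; congr (_ + _).
      under eq_bigr do rewrite !mxE eqxx/= mulrDl.
      rewrite big_split/=; congr (_ + _).
      rewrite (bigD1 j)//= eqxx mulr1 big1 ?addr0// => i ij.
      by rewrite (negbTE ij) mulr0 mul0r.
    apply: is_derive_eq.
    by rewrite /GRing.scale/=; ring.
  - by rewrite addr0 subrr sub0r big1 ?oppr0// => i _; rewrite mxE mul0r.
set L := \sum_i _.
have cv : (fun h : R => h^-1 *: (f (x + (h *: (1 : R) + t) *: v) - f (x + t *: v))) @ 0^' --> L.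
  pose K := M * norm1 v ^+ 2.
  have K0 : 0 <= K by rewrite mulr_ge0// exprn_ge0// norm1_ge0.
  apply/cvgrPdist_le => e e0; near=> h.
  have h0 : h != 0 by near: h; exact: nbhs_dnbhs_neq.
  have -> : x + (h *: (1 : R) + t) *: v = p + h *: v.
    have -> : h *: (1 : R) = h by exact: mulr1.
    by rewrite /p scalerDl addrCA addrC.
  have -> : L - h^-1 *: (f (p + h *: v) - f (x + t *: v)) =
     - (h^-1 * (f (p + h *: v) - f p - \sum_i (h *: v) ord0 i * f1 i p)).
    have -> : \sum_i (h *: v) ord0 i * f1 i p = h * L.
      by rewrite /L mulr_sumr; apply: eq_bigr => i _; rewrite mxE mulrA.
    by rewrite /GRing.scale/= -/p; field.
  rewrite normrN normrM normfV; have := fB (h *: v).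
  rewrite norm1Z exprMn -normrX => H.
  rewrite ler_pdivrMl ?normr_gt0//.
  apply: le_trans H _.
  have -> : M * (`|h ^+ 2| * norm1 v ^+ 2) = `|h| * (`|h| * K) by rewrite normrX /K; ring.
  rewrite ler_wpM2l//.
  have hK : `|h| <= e / (K + 1).
    near: h; apply: dnbhs0_le; rewrite divr_gt0//; lra.
  apply: le_trans (ler_wpM2r K0 hK) _.
  rewrite mulrAC ler_pdivrMr ?ltr_wpDl// ler_wpM2l//; lra.
apply: DeriveDef; first by apply/cvg_ex; exists L.
exact: cvg_lim cv.
Unshelve. all: by end_near.
Qed.

(** * Compactly supported smooth functions *)

Definition compactly_supported_in (K : set V) (f : V -> R) : Prop :=
  compact K /\ forall x, ~ K x -> f x = 0.

(** The complement of [K] is open, so off [K] the difference quotients are eventually 0. *)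
Lemma pD_support (K : set V) (f : V -> R) (i : 'I_d) :
  compactly_supported_in K f -> compactly_supported_in K (pD i f).
Proof.
move=> [cK f0]; split=> // x nKx.
have oK : open (~` K) by apply: closed_openC; exact: compact_closed.
rewrite /pD; apply/cvg_lim => //.
apply: cvg_near_cst.
have : \forall h \near (0 : R)^', (~` K) (h *: ebase R i + x).
  apply: cvg_within.
  have : (fun h : R => h *: ebase R i + x) @ (0 : R) --> (0 *: ebase R i + x).
    by apply: cvgD; [apply: cvgZr_tmp; exact: cvg_id|exact: cvg_cst].
  rewrite scale0r add0r; apply.
  exact: open_nbhs_nbhs.
by apply: filterS => h nK; rewrite [(f \o _) _]f0// f0// subr0 scaler0.
Qed.

Lemma compact_support_bounded (K : set V) (f : V -> R) :
  compactly_supported_in K f -> continuous f -> exists M, forall x, `|f x| <= M.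
Proof.
move=> [cK f0] cf.
have : compact (f @` K) by apply: continuous_compact => //; exact: continuous_subspaceT.
move=> /compact_bounded[M [_ HM]].
exists (`|M| + 1) => x; have [Kx|/f0->] := pselect (K x); last by rewrite normr0 addr_ge0.
apply: HM; last by exists x.
by have := ler_norm M; lra.
Qed.

(** Third order Taylor estimate on the line through [x] in direction [v]. The constant is uniform in
    [x] because all iterated partial derivatives are bounded by compact support. *)
Lemma smooth_second_difference (eta : V -> R) (K : set V) (v : V) :
  smooth eta -> compactly_supported_in K eta ->
  exists C, 0 <= C /\ forall x h, 0 < h ->
    `|eta (x + h *: v) + eta (x - h *: v) - 2 * eta x -
      h ^+ 2 * \sum_i \sum_j v ord0 i * v ord0 j * pD i (pD j eta) x| <= C * h ^+ 3.
Proof.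
move=> se sK.
have supp s : compactly_supported_in K (iter_pD s eta) by elim: s => //= i s; exact: pD_support.
have bd s : exists M, forall x, `|iter_pD s eta x| <= M.
  by apply: compact_support_bounded; [exact: supp|exact: (se s).1].
have [B HB] : exists B : seq 'I_d -> R, forall s x, `|iter_pD s eta x| <= B s.
  by have /choice[B HB] := bd; exists B.
have part s : has_partials (iter_pD s eta) (fun i => iter_pD (i :: s) eta).
  by move=> i z t; apply: is_derive_line; exact: (se s).2.
have line s x t : is_derive t (1 : R) (fun r : R => iter_pD s eta (x + r *: v))
    (\sum_i v ord0 i * iter_pD (i :: s) eta (x + t *: v)).
  apply: (@chain_rule (iter_pD s eta) (fun i => iter_pD (i :: s) eta)
    (fun i j => iter_pD [:: j, i & s] eta) (\sum_i \sum_j `|B [:: j, i & s]|)).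
  - exact: part.
  - by move=> i; exact: part.
  - move=> i j z; apply: le_trans (HB _ _) _; apply: le_trans (ler_norm _) _.
    rewrite (bigD1 i)//= (bigD1 j)//= -addrA lerDl addr_ge0// !sumr_ge0// => *; exact: sumr_ge0.
(* Bounds the third derivative of [eta] along [v], expanded in partial derivatives. *)
pose M := \sum_j `|v ord0 j| * \sum_i `|v ord0 i| * \sum_k `|v ord0 k| * `|B [:: k; i; j]|.
have M0 : 0 <= M.
  by do ![apply: sumr_ge0 => ? _; apply: mulr_ge0 => //].
exists (2 * M); split; first by rewrite mulr_ge0.
move=> x h h0.
pose g r := eta (x + r *: v).
pose g2 r := \sum_j v ord0 j * \sum_i v ord0 i * iter_pD [:: i; j] eta (x + r *: v).
have -> : \sum_i \sum_j v ord0 i * v ord0 j * pD i (pD j eta) x = g2 0.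
  rewrite /g2 scale0r addr0 exchange_big; apply: eq_bigr => j _; rewrite mulr_sumr.
  by apply: eq_bigr => i _; rewrite mulrCA mulrA.
have -> : eta (x + h *: v) + eta (x - h *: v) - 2 * eta x = g h + g (- h) - 2 * g 0.
  by rewrite /g scale0r addr0 scaleNr.
apply: (@second_difference_bound _ (fun r => \sum_j v ord0 j * iter_pD [:: j] eta (x + r *: v)) _
  (fun r => \sum_j v ord0 j * \sum_i v ord0 i * \sum_k v ord0 k * iter_pD [:: k; i; j] eta (x + r *: v))) => //.
- by move=> t; exact: (line [::]).
- by move=> t; apply: is_derive_sum_mul => j; exact: line.
- by move=> t; apply: is_derive_sum_mul => j; apply: is_derive_sum_mul => i; exact: line.
- move=> t; apply: le_trans (ler_norm_sum _ _ _) _; apply: ler_sum => j _.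
  rewrite normrM ler_wpM2l//; apply: le_trans (ler_norm_sum _ _ _) _; apply: ler_sum => i _.
  rewrite normrM ler_wpM2l//; apply: le_trans (ler_norm_sum _ _ _) _; apply: ler_sum => k _.
  rewrite normrM ler_wpM2l//; exact: le_trans (HB _ _) (ler_norm _).
Qed.

End SecondDifferences.

(** * Positive semidefinite matrices *)

Section RankOneDecomposition.
Variables (R : realType) (d : nat).
Local Notation V := 'rV[R]_d.

Definition qform (B : 'M[R]_d) (x : V) : R := \sum_i \sum_j B i j * x ord0 i * x ord0 j.

Lemma sum_delta (k : 'I_d) (F : 'I_d -> R) : \sum_i (i == k)%:R * F i = F k.
Proof.
rewrite (bigD1 k)//= eqxx mul1r big1 ?addr0// => i ik.
by rewrite (negbTE ik) mul0r.
Qed.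

Lemma qformD_ebase (B : 'M[R]_d) (x : V) (t : R) (k : 'I_d) : B^T = B ->
  qform B (x + t *: ebase R k) =
  qform B x + 2 * t * (\sum_j B k j * x ord0 j) + t ^+ 2 * B k k.
Proof.
move=> symB.
have sB i j : B i j = B j i by rewrite -{1}symB mxE.
have -> : qform B (x + t *: ebase R k) =
  \sum_i \sum_j (B i j * x ord0 i * x ord0 j + (i == k)%:R * (t * (B i j * x ord0 j))
     + (j == k)%:R * (t * (B i j * x ord0 i)) + (i == k)%:R * ((j == k)%:R * (t ^+ 2 * B i j))).
  apply: eq_bigr => i _; apply: eq_bigr => j _; rewrite !mxE !eqxx/=; ring.
under eq_bigr do rewrite !big_split/=.
rewrite !big_split/= -/(qform B x) -!addrA; congr (_ + _).
have -> : \sum_i \sum_j (i == k)%:R * (t * (B i j * x ord0 j)) = t * (\sum_j B k j * x ord0 j).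
  under eq_bigr do rewrite -mulr_sumr.
  by rewrite sum_delta mulr_sumr.
have -> : \sum_i \sum_j (j == k)%:R * (t * (B i j * x ord0 i)) = t * (\sum_j B k j * x ord0 j).
  under eq_bigr do rewrite sum_delta.
  by rewrite mulr_sumr; apply: eq_bigr => i _; rewrite sB.
have -> : \sum_i \sum_j (i == k)%:R * ((j == k)%:R * (t ^+ 2 * B i j)) = t ^+ 2 * B k k.
  under eq_bigr do rewrite -mulr_sumr.
  by rewrite !sum_delta.
ring.
Qed.

Lemma qform_ebase (B : 'M[R]_d) (k : 'I_d) : qform B (ebase R k) = B k k.
Proof.
rewrite /qform; under eq_bigr => i _.
  under eq_bigr => j _ do rewrite !ebaseE mulrC.
  rewrite sum_delta mulrC; over.
by rewrite sum_delta.
Qed.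

(* Cholesky elimination, one row and column at a time. *)
Lemma psd_sum_rank1 (B : 'M[R]_d) : B^T = B -> (forall x, 0 <= qform B x) ->
  exists vs : seq V, forall i j, B i j = \sum_(v <- vs) v ord0 i * v ord0 j.
Proof.
(* Induction on the number [n] of rows not yet eliminated: the first d - n rows are already zero. *)
suff H n : forall B : 'M[R]_d, B^T = B -> (forall x, 0 <= qform B x) ->
    (forall i j : 'I_d, (i < d - n)%N -> B i j = 0) ->
    exists vs : seq V, forall i j, B i j = \sum_(v <- vs) v ord0 i * v ord0 j.
  by move=> sB pB; apply: (H d) => // i j; rewrite subnn.
elim: n => [|n IHn] {}B symB psdB zB.
  by exists [::] => i j; rewrite big_nil zB// subn0 ltn_ord.
have sB i j : B i j = B j i by rewrite -{1}symB mxE.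
have [dn|nd] := leqP d n.
  by apply: IHn => // i j; move: (dn); rewrite -subn_eq0 => /eqP->.
have kd : (d - n.+1 < d)%N by rewrite ltn_subrL/= (leq_ltn_trans _ nd).
pose k := Ordinal kd.
have ltk (i : 'I_d) : (i < d - n)%N -> i = k \/ (i < d - n.+1)%N.
  rewrite -subnSK// ltnS leq_eqVlt => /orP[/eqP ik|]; [left; exact: val_inj|by right].
have [Bkk|Bkk] := eqVneq (B k k) 0.
  apply: IHn => // i j /ltk[->|]; last exact: zB.
  apply/eqP; apply: contraT => Bkj.
  (* A zero diagonal entry forces a zero row: if [B k j] were nonzero, the form would equal -1 at
     this vector. *)
  have := psdB (ebase R j + (- (B j j + 1) / (2 * B k j)) *: ebase R k).
  rewrite qformD_ebase// Bkk mulr0 addr0 qform_ebase.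
  under eq_bigr do rewrite ebaseE mulrC.
  rewrite sum_delta.
  have -> : B j j + 2 * (- (B j j + 1) / (2 * B k j)) * B k j = -1 by field.
  by rewrite oppr_ge0 ler10.
have Bkk0 : 0 < B k k by rewrite lt_neqAle eq_sym Bkk -qform_ebase psdB.
(* Schur complement of the k-th diagonal entry; the subtracted part is the rank one matrix added to
   the list below. *)
pose B' : 'M[R]_d := \matrix_(i, j) (B i j - B k i * B k j / B k k).
have [||i j|vs Hvs] := IHn B'.
- by apply/matrixP => i j; rewrite !mxE sB; congr (_ - _ / _); rewrite mulrC.
- move=> x; pose s := \sum_j B k j * x ord0 j.
  (* The reduced form at [x] is the minimum of the old one on the line through [x] in the k-th
     direction, hence nonnegative. *)
  have -> : qform B' x = qform B (x + (- s / B k k) *: ebase R k).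
    rewrite qformD_ebase// -/s.
    have -> : qform B' x = qform B x - s ^+ 2 / B k k.
      rewrite /qform -[s ^+ 2 / _]mulrC expr2 {1}/s mulr_suml mulr_sumr -sumrB.
      apply: eq_bigr => i _; rewrite /s !mulr_sumr -sumrB; apply: eq_bigr => j _.
      by rewrite mxE; ring.
    by field.
  exact: psdB.
- move=> /ltk[->|ik]; rewrite mxE; first by field.
  by rewrite (zB i j ik) (sB k i) (zB i k ik) mul0r mul0r subr0.
exists ((Num.sqrt (B k k))^-1 *: row k B :: vs) => i j.
rewrite big_cons -Hvs !mxE.
rewrite mulrACA -invfM -expr2 sqr_sqrtr ?ltW//; ring.
Qed.

End RankOneDecomposition.

(** * Measurability *)

Section MeasurableRd.
Variables (R : realType) (d : nat).
Local Notation V := 'rV[R]_d.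

Lemma open_rowP (U : set V) (x : V) : open U -> U x ->
  exists2 e : R, 0 < e & forall y : V, (forall i, `|x ord0 i - y ord0 i| < e) -> U y.
Proof.
move=> oU Ux; have /nbhs_ballP[e e0 eU] : nbhs x U by exact: open_nbhs_nbhs.
exists e => // y xy; apply: eU; split => [|i j]; first exact: e0.
by rewrite (ord1 i); exact: xy.
Qed.

(** An open set is the countable union of the boxes with rational centre and radius 1/(n+1) that it
    contains; [F] enumerates these boxes. *)
Lemma measurable_open_preimage (U : set V) : open U -> measurable (@rV_of_tuple R d @^-1` U).
Proof.
move=> oU.
pose Box (c : {ffun 'I_d -> rat} * nat) : set V :=
  [set y | forall i, `|ratr (c.1 i) - y ord0 i| < c.2.+1%:R^-1].
pose F n := match @unpickle ({ffun 'I_d -> rat} * nat)%type n with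
  | Some c => if `[< Box c `<=` U >] then @rV_of_tuple R d @^-1` Box c else set0
  | None => set0 end.
have mBox c : measurable (@rV_of_tuple R d @^-1` Box c).
  have -> : @rV_of_tuple R d @^-1` Box c =
    \bigcap_(i in [set: 'I_d]) ((@tnth d R)^~ i @^-1` (ball (ratr (c.1 i) : R) c.2.+1%:R^-1)).
    apply/seteqP; split=> t /= H i; last by have := H i I; rewrite !mxE.
    by move=> _; have := H i; rewrite !mxE.
  apply: fin_bigcap_measurable => // i _; rewrite -[X in measurable X]setTI.
  exact: (measurable_tnth i measurableT (measurable_ball _ _)).
have -> : @rV_of_tuple R d @^-1` U = \bigcup_n F n.
  apply/seteqP; split=> t; last first.
    by move=> [n _]; rewrite /F; case: unpickle => // c; case: asboolP => // cU; exact: cU.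
  move=> /= /(open_rowP oU)[e e0 eU].
  (* The radius 1/(q+1) is below e/2, so every point of a box of this radius containing [t] is
     within [e] of [t] in each coordinate. *)
  pose q := Num.truncn (2 / e).
  have q0 : 0 < q.+1%:R^-1 :> R by rewrite invr_gt0 ltr0n.
  have qe : q.+1%:R^-1 < e / 2 :> R.
    by rewrite -[e / 2]invrK ltf_pV2 ?posrE// ?invr_gt0 ?divr_gt0// invf_div truncnS_gt.
  have /choice[c Hc] : forall i, exists c : rat, `|ratr c - tnth t i| < q.+1%:R^-1.
    move=> i; have /rat_in_itvoo[c] : tnth t i - q.+1%:R^-1 < tnth t i + q.+1%:R^-1 by rewrite ltrD2l gtrN.
    by rewrite in_itv/= => cq; exists c; rewrite ltr_distl.
  exists (pickle ([ffun i => c i], q)) => //; rewrite /F pickleK; case: asboolP => [_ i|nU].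
    by rewrite ffunE mxE.
  exfalso; apply: nU => y yB; apply: eU => i; have := yB i; have := Hc i.
  rewrite /= !ffunE mxE => A B.
  have -> : tnth t i - y ord0 i = - (ratr (c i) - tnth t i) + (ratr (c i) - y ord0 i) by ring.
  apply: le_lt_trans (ler_normD _ _) _; rewrite normrN (splitr e).
  by rewrite ltrD // ; [exact: lt_trans A qe|exact: lt_trans B qe].
apply: bigcupT_measurable => n; rewrite /F; case: unpickle => // c.
by case: ifP.
Qed.

(** Left-unbounded open rays generate the Borel sets, so upper semicontinuity on [Om] is enough. *)
Lemma measurable_on_usc (Om : set V) (f : V -> R) :
  (forall a, open [set x | Om x /\ f x < a]) -> measurable_on Om f.
Proof.
move=> H mOm; apply: (measurability _ (RGenInftyO.measurableE R)) => //.
move=> /= _ [_ [a ->] <-].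
have -> : @rV_of_tuple R d @^-1` Om `&` (f \o @rV_of_tuple R d) @^-1` `]-oo, a[ =
  @rV_of_tuple R d @^-1` [set x | Om x /\ f x < a].
  by apply/seteqP; split=> t /=; rewrite in_itv/=.
exact: measurable_open_preimage.
Qed.

Lemma measurable_continuous_rV (f : V -> R) : continuous f ->
  measurable_fun setT (f \o @rV_of_tuple R d).
Proof.
move=> cf; have := @measurable_on_usc setT f; apply => a.
have -> : [set x | setT x /\ f x < a] = f @^-1` [set x | x < a].
  by apply/seteqP; split=> x //= [].
apply: open_comp; last exact: open_lt.
by move=> x _; exact: cf.
Qed.

End MeasurableRd.

(** * Distributional inequalities *)

Section Distributions.
Variables (R : realType) (d : nat).
Local Notation V := 'rV[R]_d.
Local Notation rV := (@rV_of_tuple R d).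

Definition integrand (f : V -> R) := bounded_box_supported (f \o rV).

Lemma integralD f g : integrand f -> integrand g ->
  integral_Rd (fun x : V => f x + g x) = integral_Rd f + integral_Rd g.
Proof. exact: iintD. Qed.

Lemma integralZ c f : integrand f -> integral_Rd (fun x : V => c * f x) = c * integral_Rd f.
Proof. exact: iintZ. Qed.

Lemma integral0 : integral_Rd (fun _ : V => 0) = 0.
Proof. exact: iint0. Qed.

Lemma integral_le f g : integrand f -> integrand g -> (forall x, f x <= g x) ->
  integral_Rd f <= integral_Rd g.
Proof. by move=> bf bg fg; apply: iint_le => // t; exact: fg. Qed.

Lemma integrandD f g : integrand f -> integrand g -> integrand (fun x : V => f x + g x).
Proof. exact: bbsD. Qed.

Lemma integrandZ c f : integrand f -> integrand (fun x : V => c * f x).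
Proof. exact: bbsZ. Qed.

Lemma integrand0 : integrand (fun _ : V => 0).
Proof. by split; [exact: measurable_cst|exists 0 => t; rewrite /= normr0]. Qed.

Lemma integrand_sum (I : Type) (s : seq I) (F : I -> V -> R) :
  (forall i, integrand (F i)) -> integrand (fun x => \sum_(i <- s) F i x).
Proof.
move=> iF; elim: s => [|i s IHs].
  rewrite (_ : (fun _ => _) = fun=> 0); first exact: integrand0.
  by apply/funext => x; rewrite big_nil.
rewrite (_ : (fun _ => _) = fun x => F i x + \sum_(i <- s) F i x); first exact: integrandD.
by apply/funext => x; rewrite big_cons.
Qed.

Lemma integral_sum (I : Type) (s : seq I) (F : I -> V -> R) :
  (forall i, integrand (F i)) ->
  integral_Rd (fun x => \sum_(i <- s) F i x) = \sum_(i <- s) integral_Rd (F i).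
Proof.
move=> iF; elim: s => [|i s IHs].
  rewrite big_nil (_ : (fun _ => _) = fun=> 0); first exact: integral0.
  by apply/funext => x; rewrite big_nil.
rewrite big_cons -IHs -integralD//; last exact: integrand_sum.
by congr (integral_Rd _); apply/funext => x; rewrite big_cons.
Qed.

Lemma rV_of_tshift (v : V) t : rV (tshift [tuple v ord0 i | i < d] t) = rV t + v.
Proof. by apply/rowP => i; rewrite !mxE !tnth_mktuple. Qed.

Lemma comp_shift (f : V -> R) (v : V) :
  (fun x => f (x + v)) \o rV = (f \o rV) \o tshift [tuple v ord0 i | i < d].
Proof. by apply/funext => t /=; rewrite rV_of_tshift. Qed.

Lemma integral_shift f (v : V) : integrand f ->
  integral_Rd (fun x => f (x + v)) = integral_Rd f.
Proof.
move=> bf; rewrite [RHS]/integral_Rd -[RHS](iint_shift [tuple v ord0 i | i < d] bf).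
by rewrite -comp_shift.
Qed.

Lemma measurable_shift (f : V -> R) (v : V) : measurable_fun setT (f \o rV) ->
  measurable_fun setT ((fun x => f (x + v)) \o rV).
Proof.
move=> mf; rewrite (comp_shift f v).
exact: (measurableT_comp mf (measurable_tshift _)).
Qed.

Definition locally_bounded (f : V -> R) : Prop :=
  forall M, exists C, forall x, norm1 x <= M -> `|f x| <= C.

Definition bounded_supported (f : V -> R) : Prop :=
  exists M, forall x, `|f x| <= M /\ (M < norm1 x -> f x = 0).

Lemma norm1D (x y : V) : norm1 (x + y) <= norm1 x + norm1 y.
Proof. by rewrite /norm1 -big_split/=; apply: ler_sum => i _; rewrite mxE ler_normD. Qed.

Lemma norm1N (x : V) : norm1 (- x) = norm1 x.
Proof. by apply: eq_bigr => i _; rewrite mxE normrN. Qed.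

Lemma coord_norm1 (x : V) i : `|x ord0 i| <= norm1 x.
Proof. by rewrite /norm1 (bigD1 i)//= lerDl sumr_ge0. Qed.

Lemma norm1_continuous : continuous (@norm1 R d).
Proof.
apply: continuous_big => [|i _ x]; first exact: add_continuous.
apply: (continuous_comp (f := fun z : V => z ord0 i)); last exact: norm_continuous.
exact: coord_continuous.
Qed.

Lemma compact_norm1_bounded (K : set V) : compact K -> exists M, forall x, K x -> norm1 x <= M.
Proof.
move=> cK; have : compact (@norm1 R d @` K).
  by apply: continuous_compact => //; exact/continuous_subspaceT/norm1_continuous.
move=> /compact_bounded[M [_ HM]]; exists (M + 1) => x Kx.
apply: le_trans (ler_norm _) (HM (M + 1) _ _ _); first lra.
by exists x.
Qed.

Lemma integrandM (P g : V -> R) : measurable_fun setT (P \o rV) -> locally_bounded P ->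
  measurable_fun setT (g \o rV) -> bounded_supported g ->
  integrand (fun x => P x * g x).
Proof.
move=> mP lP mg [M gM]; split.
  exact: (measurable_funM mP mg).
have [C HC] := lP M; exists (`|M| + `|C| * `|M|) => t /=.
have CM0 : 0 <= `|C| * `|M| by rewrite mulr_ge0.
have [g1 g2] := gM (rV t); split.
  have [tM|tM] := leP (norm1 (rV t)) M; last by rewrite g2// mulr0 normr0 addr_ge0.
  apply: le_trans (_ : `|C| * `|M| <= _); last by rewrite lerDr.
  by rewrite normrM ler_pM// ?(le_trans (HC _ tM))// ?(le_trans g1)// ler_norm.
move=> [i Mi]; rewrite g2 ?mulr0//.
have := coord_norm1 (rV t) i; rewrite mxE; have := ler_norm M; lra.
Qed.

Lemma bounded_supported_shift (g : V -> R) (v : V) :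
  bounded_supported g -> bounded_supported (fun x => g (x + v)).
Proof.
move=> [M gM]; exists (M + norm1 v) => x; have [g1 g2] := gM (x + v); split.
  by rewrite (le_trans g1)// lerDl norm1_ge0.
move=> Mx; apply: g2; have := norm1D (x + v) (- v).
rewrite addrK norm1N; lra.
Qed.

Lemma bounded_supported_continuous (K : set V) (g : V -> R) :
  compactly_supported_in K g -> continuous g -> bounded_supported g.
Proof.
move=> sK cg; have [B gB] := compact_support_bounded sK cg.
have [M KM] := compact_norm1_bounded sK.1.
exists (Num.max B M) => x; split; first by rewrite le_max gB.
rewrite gt_max => /andP[_ Mx]; apply: sK.2 => Kx.
by have := KM _ Kx; rewrite leNgt Mx.
Qed.

(* Translation invariance moves the second differences of a test function onto P. *)
Lemma distr_nonpos_of_second_differences (Om : set V) (A : 'M[R]_d) (phi P : V -> R) (vs : seq V) :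
  (forall i j, A i j = \sum_(v <- vs) v ord0 i * v ord0 j) ->
  P = (fun x => if x \in Om then phi x else 0) ->
  measurable_fun setT (P \o rV) -> locally_bounded P ->
  (forall K : set V, compact K -> K `<=` Om -> exists2 h0 : R, 0 < h0 & forall (x : V) (h : R), K x -> 0 < h <= h0 ->
     \sum_(v <- vs) (P (x + h *: v) + P (x - h *: v) - 2 * P x) <= 0) ->
  distr_nonpos Om A phi.
Proof.
move=> AE PE mP lP HP eta [se [eta0 [K [cK [KOm etaK]]]]].
have sK : compactly_supported_in K eta by [].
(* [q v] is the second derivative of [eta] along [v]; its sum over [vs] is the operator with matrix
   [A] applied to [eta]. *)
pose q (v x : V) : R := \sum_i \sum_j v ord0 i * v ord0 j * pD i (pD j eta) x.
have iq v : integrand (fun x => P x * q v x).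
  rewrite (_ : (fun x => _) = fun x => \sum_i \sum_j v ord0 i * v ord0 j * (P x * pD i (pD j eta) x)).
    apply: integrand_sum => i; apply: integrand_sum => j; apply: integrandZ.
    have c2 : continuous (pD i (pD j eta)) by exact: (se [:: i; j]).1.
    apply: integrandM => //; first exact: measurable_continuous_rV.
    by apply: (bounded_supported_continuous (K := K)) => //; do 2 apply: pD_support.
  apply/funext => x; rewrite /q mulr_sumr; apply: eq_bigr => i _.
  by rewrite mulr_sumr; apply: eq_bigr => j _; rewrite mulrCA.
have -> : integral_Rd (fun x => if x \in Om then
    phi x * \sum_i \sum_j A i j * pD i (pD j eta) x else 0) =
    \sum_(v <- vs) integral_Rd (fun x => P x * q v x).
  rewrite -integral_sum//; congr (integral_Rd _); apply/funext => x.
  rewrite PE -mulr_sumr; case: ifP => _; last by rewrite mul0r.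
  congr (_ * _); rewrite /q [RHS]exchange_big; apply: eq_bigr => i _.
  rewrite [RHS]exchange_big; apply: eq_bigr => j _.
  by rewrite AE mulr_suml.
have ceta : continuous eta := (se [::]).1.
have beta : bounded_supported eta := bounded_supported_continuous sK ceta.
have meta : measurable_fun setT (eta \o rV) := measurable_continuous_rV ceta.
have [C HC] : exists C : V -> R, forall v, 0 <= C v /\ forall x h, 0 < h ->
    `|eta (x + h *: v) + eta (x - h *: v) - 2 * eta x - h ^+ 2 * q v x| <= C v * h ^+ 3.
  have /choice[C HC] : forall v, exists C, 0 <= C /\ forall x h, 0 < h ->
    `|eta (x + h *: v) + eta (x - h *: v) - 2 * eta x - h ^+ 2 * q v x| <= C * h ^+ 3.
    by move=> v; exact: smooth_second_difference se sK.
  by exists C.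
have [M KM] := compact_norm1_bounded cK.
(* For steps at most 1 the second difference of [eta] along [v] vanishes once the norm exceeds M +
   norm1 v. The indicator confines the Taylor error to that region, where it can be integrated
   against |P|. *)
pose ind r (x : V) : R := if norm1 x <= r then 1 else 0.
have iind r : integrand (fun x => `|P x| * ind r x).
  apply: integrandM.
  - exact: (measurableT_comp (@normr_measurable R setT) mP).
  - by move=> M'; have [C' HC'] := lP M'; exists C' => x /HC'; rewrite normr_id.
  - apply: measurable_fun_ifT => //.
    apply: measurable_fun_ler => //.
    exact: (measurable_continuous_rV norm1_continuous).
  - exists (Num.max r 1) => x; rewrite /ind; split.
      by case: ifP => _; rewrite ?normr0 ?normr1 le_max ?ler01 ?lexx ?orbT.
    by rewrite gt_max => /andP[rx _]; rewrite leNgt rx.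
pose J v := C v * integral_Rd (fun x => `|P x| * ind (M + norm1 v) x).
have ish v : integrand (fun x => P x * eta (x + v)).
  apply: integrandM => //; first exact: measurable_shift.
  exact: bounded_supported_shift.
have lPs v : locally_bounded (fun x => P (x + v)).
  move=> r; have [C' HC'] := lP (r + norm1 v); exists C' => x xr; apply: HC'.
  by apply: le_trans (norm1D _ _) _; rewrite lerD2r.
have ish' v : integrand (fun x => P (x + v) * eta x).
  by apply: integrandM => //; exact: (measurable_shift _ mP).
have iP0 : integrand (fun x => P x * eta x) by exact: integrandM.
have shE v : integral_Rd (fun x => P x * eta (x + v)) = integral_Rd (fun x => P (x - v) * eta x).
  rewrite -(integral_shift v (ish' (- v))).
  by congr (integral_Rd _); apply/funext => x; rewrite addrK.
have comb (a b c e : V -> R) : integrand a -> integrand b -> integrand c ->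
    (forall x, e x = a x + b x + (-2) * c x) ->
    integrand e /\ integral_Rd e = integral_Rd a + integral_Rd b + (-2) * integral_Rd c.
  move=> ia ib ic eE; rewrite (_ : e = fun x => a x + b x + (-2) * c x); last exact/funext.
  split; first by apply: integrandD; [exact: integrandD|exact: integrandZ].
  by rewrite integralD ?integralZ ?integralD//; [exact: integrandD|exact: integrandZ].
(* Discrete integration by parts: the second difference moves from [eta] to [P] by translation
   invariance. *)
have swap h v : integrand (fun x => P x * (eta (x + h *: v) + eta (x - h *: v) - 2 * eta x)) /\
    integrand (fun x => (P (x + h *: v) + P (x - h *: v) - 2 * P x) * eta x) /\
    integral_Rd (fun x => P x * (eta (x + h *: v) + eta (x - h *: v) - 2 * eta x)) =
    integral_Rd (fun x => (P (x + h *: v) + P (x - h *: v) - 2 * P x) * eta x).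
  have [i1 ->] := comb _ _ _ (fun x => P x * (eta (x + h *: v) + eta (x - h *: v) - 2 * eta x))
    (ish (h *: v)) (ish (- (h *: v))) iP0 ltac:(by move=> x /=; ring).
  have [i2 ->] := comb _ _ _ (fun x => (P (x + h *: v) + P (x - h *: v) - 2 * P x) * eta x)
    (ish' (h *: v)) (ish' (- (h *: v))) iP0 ltac:(by move=> x /=; ring).
  by split => //; split => //; rewrite !shE opprK; ring.
have [h0 h0pos Hh0] := HP K cK KOm.
set I := \sum_(v <- vs) _.
(* Up to an error of order h^3, h^2 I is a sum of integrals of second differences of [P] against
   [eta], which is nonpositive; then h^2 is divided out. *)
have key h : 0 < h -> h <= h0 -> h <= 1 -> I <= h * \sum_(v <- vs) J v.
  move=> hpos hh0 h1.
  have neg : \sum_(v <- vs) integral_Rd (fun x => P x * (eta (x + h *: v) + eta (x - h *: v) - 2 * eta x)) <= 0.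
    rewrite (eq_bigr _ (fun v _ => (swap h v).2.2)) -integral_sum => [|v]; last exact: (swap h v).2.1.
    rewrite -[leRHS]integral0; apply: integral_le.
    - by apply: integrand_sum => v; exact: (swap h v).2.1.
    - exact: integrand0.
    - move=> x; rewrite -mulr_suml; have [Kx|nKx] := pselect (K x).
        by rewrite mulr_le0_ge0// Hh0// hpos.
      by rewrite etaK// mulr0.
  have each v : h ^+ 2 * integral_Rd (fun x => P x * q v x) <=
      integral_Rd (fun x => P x * (eta (x + h *: v) + eta (x - h *: v) - 2 * eta x)) + h ^+ 3 * J v.
    rewrite -integralZ// /J mulrA -integralZ// -integralD//; [|exact: (swap h v).1|exact: integrandZ].
    apply: integral_le; [exact: integrandZ| |].
      by apply: integrandD; [exact: (swap h v).1|exact: integrandZ].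
    move=> x; have [C0 /(_ x h hpos)] := HC v.
    set D := eta _ + _ - _ => HD.
    rewrite /ind; case: ifPn => xM.
      have : P x * (h ^+ 2 * q v x - D) <= `|P x| * (C v * h ^+ 3).
        apply: le_trans (ler_norm _) _; rewrite normrM ler_wpM2l// distrC; exact: HD.
      rewrite mulr1; lra.
    have vM : norm1 (h *: v) <= norm1 v.
      by rewrite norm1Z gtr0_norm// ler_piMl// norm1_ge0.
    have far w : norm1 w <= norm1 v -> ~ K (x + w).
      move=> wv Kxw; move/negP: xM; apply; have := KM _ Kxw.
      have := norm1D (x + w) (- w); rewrite addrK norm1N; lra.
    have nK : ~ K x by rewrite -[x]addr0; apply: far; rewrite /norm1 big1 ?sumr_ge0// => i _; rewrite mxE normr0.
    have -> : D = 0.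
      rewrite /D !etaK ?addr0 ?mulr0 ?subr0//; apply: far => //; by rewrite norm1N.
    rewrite /q big1 ?mulr0 ?addr0// => i _; rewrite big1// => j _.
    by rewrite (pD_support i (pD_support j sK)).2// mulr0.
  have h2 : 0 < h ^+ 2 by rewrite exprn_gt0.
  rewrite -(ler_pM2l h2) mulr_sumr.
  apply: le_trans (ler_sum _ (fun v _ => each v)) _; rewrite big_split/= -mulr_sumr.
  have -> : h ^+ 2 * (h * \sum_(v <- vs) J v) = h ^+ 3 * \sum_(v <- vs) J v by ring.
  by rewrite -[leRHS]add0r lerD2r.
rewrite leNgt; apply/negP => I0.
set S := \sum_(v <- vs) J v in key.
(* Small enough that h S is at most I/2, which contradicts [key] if I is positive. *)
pose h := Num.min (Num.min h0 1) (I / (2 * (`|S| + 1))).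
have S1 : 0 < `|S| + 1 by rewrite ltr_wpDl.
have hpos : 0 < h by rewrite !lt_min h0pos ltr01/= divr_gt0// mulr_gt0.
have := key h hpos.
rewrite /h !ge_min !lexx !orbT/= => /(_ isT isT); rewrite -/h => IS.
have : h * S <= I / 2.
  have SS : S <= `|S| + 1 by have := ler_norm S; lra.
  apply: le_trans (ler_wpM2l (ltW hpos) SS) _; rewrite -ler_pdivlMr//.
  have -> : I / 2 / (`|S| + 1) = I / (2 * (`|S| + 1)) by rewrite invfM mulrA.
  by rewrite /h ge_min lexx orbT.
lra.
Qed.

End Distributions.

(** * Euclidean geometry *)

Section EuclideanGeometry.
Variables (R : realType) (d : nat).
Local Notation V := 'rV[R]_d.

Lemma dotvC (x y : V) : dotv x y = dotv y x.
Proof. by apply: eq_bigr => i _; rewrite mulrC. Qed.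

Lemma dotvDl (x y z : V) : dotv (x + y) z = dotv x z + dotv y z.
Proof. by rewrite /dotv -big_split; apply: eq_bigr => i _; rewrite mxE mulrDl. Qed.

Lemma dotvZl (c : R) (x z : V) : dotv (c *: x) z = c * dotv x z.
Proof. by rewrite /dotv mulr_sumr; apply: eq_bigr => i _; rewrite mxE mulrA. Qed.

Lemma dotvNl (x z : V) : dotv (- x) z = - dotv x z.
Proof. by rewrite -scaleN1r dotvZl mulN1r. Qed.

Lemma dotvDr (x y z : V) : dotv z (x + y) = dotv z x + dotv z y.
Proof. by rewrite !(dotvC z) dotvDl. Qed.

Lemma dotvZr (c : R) (x z : V) : dotv z (c *: x) = c * dotv z x.
Proof. by rewrite !(dotvC z) dotvZl. Qed.

Lemma dotvNr (x z : V) : dotv z (- x) = - dotv z x.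
Proof. by rewrite !(dotvC z) dotvNl. Qed.

Definition dotvE := (dotvDl, dotvDr, dotvZl, dotvZr, dotvNl, dotvNr).

Lemma dotv_ge0 (x : V) : 0 <= dotv x x.
Proof. by apply: sumr_ge0 => i _; rewrite -expr2 sqr_ge0. Qed.

Lemma enorm_ge0 (x : V) : 0 <= enorm x.
Proof. exact: sqrtr_ge0. Qed.

Lemma sqr_enorm (x : V) : enorm x ^+ 2 = dotv x x.
Proof. by rewrite sqr_sqrtr// dotv_ge0. Qed.

Lemma enormN (x : V) : enorm (- x) = enorm x.
Proof. by rewrite /enorm !dotvE opprK. Qed.

Lemma enormZ (c : R) (x : V) : enorm (c *: x) = `|c| * enorm x.
Proof. by rewrite /enorm !dotvE mulrA -expr2 sqrtrM ?sqr_ge0// sqrtr_sqr. Qed.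

Lemma enorm_lt (x : V) (r : R) : 0 < r -> (enorm x < r) = (dotv x x < r ^+ 2).
Proof.
by move=> r0; rewrite -sqr_enorm ltr_sqr// nnegrE ?enorm_ge0// ltW.
Qed.

(** The squared length of [z] minus its projection on [e] is nonnegative. *)
Lemma dotv_unit_sqr (z e : V) : enorm e = 1 -> dotv z e ^+ 2 <= dotv z z.
Proof.
move=> e1; have ee : dotv e e = 1 by rewrite -sqr_enorm e1 expr1n.
have := dotv_ge0 (z - dotv z e *: e); rewrite !dotvE (dotvC e z) ee; nra.
Qed.

Lemma dotv_unit_norm (z e : V) : enorm e = 1 -> `|dotv z e| <= enorm z.
Proof.
move=> e1; have := dotv_unit_sqr z e1; rewrite -sqr_enorm -real_normK ?num_real//.
by rewrite ler_sqr// nnegrE ?normr_ge0 ?enorm_ge0.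
Qed.

Lemma dotv_ebaser (x : V) i : dotv x (ebase R i) = x ord0 i.
Proof.
by rewrite /dotv; under eq_bigr do rewrite ebaseE mulrC; rewrite sum_delta.
Qed.

Lemma enorm_ebase i : enorm (@ebase R d i) = 1.
Proof. by rewrite /enorm dotv_ebaser ebaseE eqxx sqrtr1. Qed.

Lemma coord_enorm (x : V) i : `|x ord0 i| <= enorm x.
Proof. by rewrite -dotv_ebaser dotv_unit_norm// enorm_ebase. Qed.

Lemma enorm_norm1 (x : V) : enorm x <= norm1 x.
Proof.
rewrite -ler_sqr ?nnegrE ?enorm_ge0 ?norm1_ge0// sqr_enorm expr2 {2}/norm1 mulr_sumr.
apply: ler_sum => i _; rewrite -expr2 -real_normK ?num_real// expr2.
by rewrite ler_wpM2r// coord_norm1.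
Qed.

Lemma rV_coord_continuous i : continuous (fun z : V => z ord0 i).
Proof. exact: coord_continuous. Qed.

Lemma dotv_sqrD_le (u z : V) : dotv (u + z) (u + z) <= 2 * (dotv u u + dotv z z).
Proof. by have := dotv_ge0 (u - z); rewrite !dotvE (dotvC z u); lra. Qed.

Lemma dotv_continuous (e : V) : continuous (fun x : V => dotv x e).
Proof.
apply: continuous_big => [|i _ x]; first exact: add_continuous.
by apply: continuousM; [exact: rV_coord_continuous|exact: cst_continuous].
Qed.

Lemma dotv_self_continuous : continuous (fun x : V => dotv x x).
Proof.
apply: continuous_big => [|i _ x]; first exact: add_continuous.
by apply: continuousM; exact: rV_coord_continuous.
Qed.

Lemma shift_continuous (p : V) : continuous (fun x : V => x - p).
Proof.
by move=> x; apply: (@continuousB R V V id (cst p)) => //; exact: cst_continuous.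
Qed.

Lemma open_eball (p : V) (r : R) : open (eball p r).
Proof.
have [r0|r0] := leP r 0.
  rewrite (_ : eball p r = set0); first exact: open0.
  apply/seteqP; split=> x //=; rewrite /eball/= ltNge => /negP; apply.
  exact: le_trans r0 (enorm_ge0 _).
rewrite (_ : eball p r = (fun x => dotv (x - p) (x - p)) @^-1` [set t | t < r ^+ 2]); last first.
  by apply/seteqP; split=> x /=; rewrite /eball/= enorm_lt.
apply: open_comp; last exact: open_lt.
move=> x _; apply: (continuous_comp (f := fun x : V => x - p) (g := fun x : V => dotv x x)).
  exact: shift_continuous.
exact: dotv_self_continuous.
Qed.

(** Used to place points in a component: it is enough that the segment joining them stays in the
    set. *)
Lemma connected_component_segment (W : set V) (x y : V) :
  (forall t : R, 0 <= t <= 1 -> W (x + t *: (y - x))) -> connected_component W x y.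
Proof.
move=> Wxy; exists ((fun t : R => x + t *: (y - x)) @` `[0, 1]); last first.
  by exists 1; rewrite /= ?in_itv/= ?lexx ?ler01// scale1r addrCA subrr addr0.
split.
- by exists 0; rewrite /= ?in_itv/= ?lexx ?ler01// scale0r addr0.
- by move=> _ [t /= + <-]; rewrite in_itv/= => /Wxy.
- apply: connected_continuous_connected; first exact: segment_connected.
  apply: continuous_subspaceT => t.
  by apply: cvgD; [exact: cvg_cst|apply: cvgZr_tmp; exact: cvg_id].
Qed.

(** * The boundary and the distance to it *)

Lemma bdry_nonempty (Om : set V) : open Om -> Om !=set0 -> Om != setT -> exists p, bdry Om p.
Proof.
move=> oOm [x0 Ox0] /eqP nT; apply: contrapT => nb; apply: nT.
(* With empty boundary [Om] would be open and closed, hence the whole space, which is connected. *)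
have cT : connected [set: V].
  rewrite -(_ : connected_component setT x0 = setT); first exact: component_connected.
  by apply/seteqP; split=> y // _; exact: connected_component_segment.
apply: cT; first by exists x0.
  by exists Om; rewrite ?setTI.
exists Om; rewrite ?setTI// => x cx; apply: contrapT => nx; apply: nb; exists x; split=> //.
by move=> /interior_subset.
Qed.

Lemma bdry_open_notin (Om : set V) p : open Om -> bdry Om p -> ~ Om p.
Proof. by move=> /interior_id oOm [_ nOm] Op; apply: nOm; rewrite oOm. Qed.

Lemma rho_le (Om : set V) x p : bdry Om p -> rho Om x <= enorm (x - p).
Proof.
move=> bp; apply: ge_inf; last by exists p => //; exact: bp.
by exists 0 => _ [q _ <-]; exact: enorm_ge0.
Qed.

Lemma rho_adherent (Om : set V) x t : (exists p, bdry Om p) -> rho Om x < t ->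
  exists2 p, bdry Om p & enorm (x - p) < t.
Proof.
move=> [p bp] /inf_lt[|_ [q bq <-] qt]; last by exists q.
by exists (enorm (x - p)); exists p.
Qed.

Lemma open_enormP (Om : set V) x : open Om -> Om x ->
  exists2 e : R, 0 < e & forall y, enorm (y - x) < e -> Om y.
Proof.
move=> oOm /(open_rowP oOm)[e e0 eOm]; exists e => // y yx; apply: eOm => i.
by apply: le_lt_trans yx; have := coord_enorm (y - x) i; rewrite !mxE distrC.
Qed.

Lemma rho_ge (Om : set V) x e : open Om -> (exists p, bdry Om p) ->
  (forall y, enorm (y - x) < e -> Om y) -> e <= rho Om x.
Proof.
move=> oOm [p0 bp0] eOm; apply: lb_le_inf; first by exists (enorm (x - p0)); exists p0.
move=> _ [p bp <-]; rewrite leNgt; apply/negP => xp; apply: (bdry_open_notin oOm bp).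
by apply: eOm; rewrite -enormN opprB.
Qed.

Lemma rho_gt0 (Om : set V) x : open Om -> (exists p, bdry Om p) -> Om x -> 0 < rho Om x.
Proof.
move=> oOm bne /(open_enormP oOm)[e e0 eOm].
exact: lt_le_trans e0 (rho_ge oOm bne eOm).
Qed.

(** The near-covering form of compactness turns the radii available around single points into one
    radius on [K]; it fixes the step of the second differences. *)
Lemma compact_uniform_interior (Om K : set V) : open Om -> compact K -> K `<=` Om ->
  exists2 e : R, 0 < e & forall x y, K x -> enorm (y - x) < e -> Om y.
Proof.
move=> oOm /compact_near_coveringP cK KOm.
have : \forall e \near (0 : R)^'+, K `<=` (fun x => forall y, enorm (y - x) < e -> Om y).
  apply: cK => x Kx; have [e e0 eOm] := open_rowP oOm (KOm _ Kx).
  exists (ball x (e / 2), [set t : R | t < e / 2]) => /=.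
    split; first by apply: nbhsx_ballx; rewrite divr_gt0.
    by apply: nbhs_right_lt; rewrite divr_gt0.
  move=> [x' t] /= [xx' te] y yx'; apply: eOm => i.
  have := xx'.2 ord0 i; have := coord_enorm (y - x') i; rewrite /ball/= !mxE => A B.
  have -> : x ord0 i - y ord0 i = (x ord0 i - x' ord0 i) - (y ord0 i - x' ord0 i) by ring.
  apply: le_lt_trans (ler_normB _ _) _; lra.
move=> H; near (0 : R)^'+ => e.
have He : K `<=` (fun x => forall y, enorm (y - x) < e -> Om y) by near: e; exact: H.
by exists e => // x y Kx; exact: He.
Unshelve. all: by end_near.
Qed.

End EuclideanGeometry.

(** * The infimum of the barriers *)

Section Barriers.
Variables (R : realType) (d : nat).
Local Notation V := 'rV[R]_d.

(* In coordinates scaled by r, with s the height above the hyperplane bounding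
   the domain: 2 K s - K s^2 + |z|^2, a supersolution when K is large. *)
Definition profile (K theta r : R) (u e : V) : R :=
  2 * K * (theta - dotv u e / r) + dotv u u / r ^+ 2 - K * (theta - dotv u e / r) ^+ 2.

Lemma profile_second_difference K theta r (u w e : V) :
  profile K theta r (u + w) e + profile K theta r (u - w) e - 2 * profile K theta r u e =
  2 / r ^+ 2 * (dotv w w - K * dotv w e ^+ 2).
Proof.
have -> : 2 / r ^+ 2 = 2 * r^-1 ^+ 2 by rewrite exprVn.
by rewrite /profile -!exprVn !dotvE (dotvC w u); ring.
Qed.

Lemma profile_continuous K theta r (e p : V) : continuous (fun x : V => profile K theta r (x - p) e).
Proof.
have c1 : continuous (fun x : V => dotv (x - p) e).
  move=> x; apply: (continuous_comp (f := fun x : V => x - p) (g := fun x : V => dotv x e)).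
    exact: shift_continuous.
  exact: dotv_continuous.
have c2 : continuous (fun x : V => dotv (x - p) (x - p)).
  move=> x; apply: (continuous_comp (f := fun x : V => x - p) (g := fun x : V => dotv x x)).
    exact: shift_continuous.
  exact: dotv_self_continuous.
have cc (c : R) : continuous (fun _ : V => c) by exact: cst_continuous.
have cs : continuous (fun x : V => theta - dotv (x - p) e / r).
  by move=> x; exact: (continuousB (cc theta x) (continuousM (c1 x) (cc r^-1 x))).
move=> x; apply: (continuousB (continuousD (continuousM (cc (2 * K) x) (cs x))
  (continuousM (c2 x) (cc (r ^+ 2)^-1 x)))).
exact: (continuousM (cc K x) (continuousM (cs x) (cs x))).
Qed.

End Barriers.

Section Construction.
Variables (R : realType) (d : nat).
Local Notation V := 'rV[R]_d.
Variables (K theta mu Lam R0 Rinf : R) (Om : set V).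

Definition admissible r := 0 < r /\ (r <= R0 \/ Rinf <= r).

(** The factor [Lam] at small scales pays for the jump over the uncontrolled scales between [R0] and
    [Rinf]. *)
Definition weight r := (if r <= R0 then Lam else 1) * r `^ mu.

Definition barrier (p : V) r (e x : V) := weight r * (profile K theta r (x - p) e + theta).

(** Different components in one ball may need different directions, so [e] is tested on the
    component of [x] alone. *)
Definition member (p : V) r (e x : V) : Prop :=
  [/\ bdry Om p, admissible r, enorm e = 1, (Om `&` eball p r) x &
    forall y, connected_component (Om `&` eball p r) x y -> dotv (y - p) e < theta * r].

Definition barriers_at (x : V) : set R :=
  [set b | exists p r e, member p r e x /\ b = barrier p r e x].

Definition phi (x : V) : R := inf (barriers_at x).

Hypothesis K0 : 0 < K.
Hypothesis theta0 : 0 < theta.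
Hypothesis theta_le : theta <= 8^-1.
Hypothesis mu0 : 0 < mu.
Hypothesis Lam1 : 1 <= Lam.
Hypothesis R00 : 0 < R0.
Hypothesis R0Rinf : R0 <= Rinf.
Hypothesis theta_small : theta^-1 `^ mu * ((4 * K + 2) * theta) <= 4^-1.
Hypothesis Lam_gap : Rinf `^ mu <= Lam * R0 `^ mu.
Hypothesis oOm : open Om.
Hypothesis bne : exists p, bdry Om p.
Hypothesis exterior : forall r p x, admissible r -> bdry Om p -> (Om `&` eball p r) x ->
  exists e : V, enorm e = 1 /\
    forall y, connected_component (Om `&` eball p r) x y -> dotv (y - p) e < theta * r.

Lemma weight_bounds r : 0 <= r -> r `^ mu <= weight r <= Lam * r `^ mu.
Proof.
move=> r0; have rm := powR_ge0 r mu.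
rewrite /weight; case: ifP => _; rewrite ?lexx ?andbT ?mul1r ?lexx/=; by rewrite ler_peMl.
Qed.

Lemma weight_gt0 r : 0 < r -> 0 < weight r.
Proof.
by move=> r0; have /andP[+ _] := weight_bounds (ltW r0); apply: lt_le_trans; exact: powR_gt0.
Qed.

Lemma exists_member p r x : admissible r -> bdry Om p -> (Om `&` eball p r) x ->
  exists e, member p r e x.
Proof. by move=> ar bp xr; have [e [e1 He]] := exterior ar bp xr; exists e. Qed.

(** The height above the hyperplane is positive because [x] lies in its own component; the upper
    bound is Cauchy-Schwarz. *)
Lemma member_slope p r e x a : member p r e x -> enorm (x - p) <= a * r ->
  0 < theta - dotv (x - p) e / r <= theta + a.
Proof.
move=> [_ [r0 _] e1 xr He] xa; apply/andP; split.
  by rewrite subr_gt0 ltr_pdivrMr// He//; exact: connected_component_refl.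
rewrite lerD2l lerNl ler_pdivlMr// mulNr lerNl.
apply: le_trans xa; apply: le_trans (dotv_unit_norm _ e1).
by rewrite -normrN ler_norm.
Qed.

Lemma member_enorm p r e x : member p r e x -> enorm (x - p) < r.
Proof. by case=> _ _ _ []. Qed.

Lemma barrier_ge p r e x : member p r e x ->
  weight r * (dotv (x - p) (x - p) / r ^+ 2 + theta) <= barrier p r e x.
Proof.
move=> mx; have [_ [r0 _] _ _ _] := mx.
have xr : enorm (x - p) <= 1 * r by rewrite mul1r ltW// (member_enorm mx).
have /andP[s0 s1] := member_slope mx xr.
rewrite /barrier ler_pM2l ?weight_gt0// lerD2r /profile.
move: s0 s1; set s := theta - _ => s0 s1.
have s2 : s <= 2 by have := theta_le; lra.
have : 0 <= K * (s * (2 - s)) by rewrite !mulr_ge0 ?(ltW K0) ?(ltW s0) ?subr_ge0.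
set q := _ / r ^+ 2; nra.
Qed.

Lemma barrier_le p r e x a : member p r e x -> enorm (x - p) <= a * r ->
  barrier p r e x <= weight r * (2 * K * (theta + a) + a ^+ 2 + theta).
Proof.
move=> mx xa; have [_ [r0 _] _ _ _] := mx.
have /andP[s0 s1] := member_slope mx xa.
rewrite /barrier ler_pM2l ?weight_gt0// lerD2r /profile.
have q2 : dotv (x - p) (x - p) / r ^+ 2 <= a ^+ 2.
  rewrite ler_pdivrMr ?exprn_gt0// -exprMn -sqr_enorm ler_sqr ?nnegrE ?enorm_ge0//.
  exact: le_trans (enorm_ge0 _) xa.
move: s0 s1 q2; set s := theta - _; set q := _ / r ^+ 2 => s0 s1 q2.
have : 0 <= K * s ^+ 2 by rewrite mulr_ge0 ?(ltW K0) ?sqr_ge0.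
have : 2 * K * s <= 2 * K * (theta + a) by rewrite ler_pM2l// mulr_gt0.
lra.
Qed.

(** The added [theta] alone suffices: the ball of radius [r] about a boundary point contains [x], so
    [r] is at least the distance to the boundary. *)
Lemma barrier_lower p r e x : member p r e x -> theta * rho Om x `^ mu <= barrier p r e x.
Proof.
move=> mx; apply: le_trans (barrier_ge mx); have [bp [r0 _] _ _ _] := mx.
have /andP[wr _] := weight_bounds (ltW r0).
rewrite mulrC; apply: (@le_trans _ _ (weight r * theta)).
  rewrite ler_pM2r//; apply: le_trans wr.
  have rx := le_trans (rho_le x bp) (ltW (member_enorm mx)).
  have rho0 : 0 <= rho Om x.
    by have [_ _ _ [Ox _] _] := mx; exact/ltW/rho_gt0.
  by apply: ge0_ler_powR => //; rewrite ?nnegrE ltW.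
by rewrite ler_pM2l ?weight_gt0// lerDr divr_ge0 ?dotv_ge0// exprn_ge0// ltW.
Qed.

Lemma barriers_lbound x : has_lbound (barriers_at x).
Proof.
exists 0 => _ [p [r [e [mx ->]]]]; apply: le_trans (barrier_lower mx).
by rewrite mulr_ge0 ?powR_ge0// ltW.
Qed.

Lemma phi_le_barrier p r e x : member p r e x -> phi x <= barrier p r e x.
Proof. by move=> mx; apply: ge_inf; [exact: barriers_lbound|exists p, r, e]. Qed.

(** The next scale is r / theta when this is admissible, and [Rinf] otherwise. *)
Lemma next_scale r : admissible r -> exists r', [/\ admissible r', r <= theta * r' &
  weight r' <= theta^-1 `^ mu * weight r].
Proof.
move=> [r0 ar].
have t0 : 0 < theta^-1 by rewrite invr_gt0.
have rt0 : 0 < theta^-1 * r by rewrite mulr_gt0.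
have rt : r <= theta^-1 * r.
  rewrite ler_peMl ?(ltW r0)// invf_ge1//; have := theta_le; lra.
have pM : (theta^-1 * r) `^ mu = theta^-1 `^ mu * r `^ mu by rewrite powRM// ltW.
have tK : theta * (theta^-1 * r) = r by rewrite mulVKf// gt_eqF.
have tmu : 0 <= theta^-1 `^ mu by exact: powR_ge0.
have rmu : 0 <= r `^ mu by exact: powR_ge0.
have [rR0|R0r] := leP (theta^-1 * r) R0.
  exists (theta^-1 * r); split=> //; [by split=> //; left|by rewrite tK|].
  by rewrite /weight rR0 (le_trans rt rR0) pM mulrCA.
have wr : weight (theta^-1 * r) = theta^-1 `^ mu * r `^ mu.
  by rewrite /weight leNgt R0r/= mul1r.
have [Rr|rR] := leP Rinf (theta^-1 * r).
  exists (theta^-1 * r); split=> //; [by split=> //; right|by rewrite tK|].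
  by rewrite wr ler_wpM2l//; have /andP[] := weight_bounds (ltW r0).
(* Here r / theta lies strictly between [R0] and [Rinf]. Then r is at most [R0], so its weight
   carries [Lam], and [Lam_gap] bounds the weight of [Rinf]. *)
exists Rinf; split.
- by split; [exact: lt_le_trans R0Rinf|right].
- by rewrite -ler_pdivrMl// ltW.
have rR0 : r <= R0.
  by case: ar => // Rr; have := le_lt_trans Rr (le_lt_trans rt rR); rewrite ltxx.
have nR : (Rinf <= R0) = false by apply/negbTE; rewrite -ltNge; exact: lt_trans rR.
rewrite /weight nR rR0 mul1r; apply: le_trans Lam_gap _.
rewrite mulrCA -pM ler_wpM2l ?(le_trans ler01)//.
by apply: ge0_ler_powR; rewrite ?nnegrE ?ltW.
Qed.

(* Where a barrier is used near the edge of its ball, a barrier in a larger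
   concentric ball lies below it; this is what makes the infimum a supersolution. *)
Lemma inner_member p r e x : member p r e x -> exists r' e',
  [/\ member p r' e' x, enorm (x - p) < r' / 2 & barrier p r' e' x <= barrier p r e x].
Proof.
move=> mx; have [xr|rx] := ltP (enorm (x - p)) (r / 2); first by exists r, e.
have [bp ar e1 [Ox _] _] := mx; have [r0 _] := ar.
have [r' [ar' rr' wr']] := next_scale ar; have [r'0 _] := ar'.
have xr := member_enorm mx.
have xr'2 : enorm (x - p) < r' / 2.
  apply: lt_le_trans xr _; apply: le_trans rr' _; rewrite mulrC ler_pM2l//.
  have := theta_le; lra.
have [|e' mx'] := @exists_member p r' x ar' bp.
  by split=> //; rewrite /eball/=; lra.
exists r', e'; split=> //.
(* At scale r' the point is within theta of the centre, so the new barrier is at most (4K+2) theta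
   times its weight. *)
have xt : enorm (x - p) <= theta * r' by exact: le_trans (ltW xr) rr'.
apply: le_trans (barrier_le mx' xt) _; apply: le_trans (barrier_ge mx).
have A : 2 * K * (theta + theta) + theta ^+ 2 + theta <= (4 * K + 2) * theta.
  have := theta_le; have := theta0; nra.
have w'0 := weight_gt0 r'0; have w0 := weight_gt0 r0.
apply: le_trans (ler_wpM2l (ltW w'0) A) _.
have K2 : 0 <= (4 * K + 2) * theta by rewrite mulr_ge0 ?(ltW theta0)//; have := K0; lra.
apply: le_trans (ler_wpM2r K2 wr') _.
rewrite mulrAC [leLHS]mulrC ler_pM2l//; apply: le_trans theta_small _.
(* In the outer half of the ball the term |z|^2 is already at least 1/4. *)
have : 4^-1 <= dotv (x - p) (x - p) / r ^+ 2.
  rewrite ler_pdivlMr ?exprn_gt0// -sqr_enorm.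
  have -> : 4^-1 * r ^+ 2 = (r / 2) ^+ 2 by field.
  by rewrite ler_sqr ?nnegrE ?enorm_ge0// divr_ge0// ltW.
have := theta0; lra.
Qed.

Lemma member_transport p r e x y : member p r e x ->
  connected_component (Om `&` eball p r) x y -> member p r e y.
Proof.
move=> [bp ar e1 xr He] xy; split=> //; first exact: (connected_component_sub xy).
by move=> z yz; apply: He; exact: connected_component_trans xy yz.
Qed.

(** The segment from [x] to [x + w] stays in [Om] by the choice of [eps]. It stays in the ball
    because [eps] is at most the distance from [x] to [p], which is below r/2. *)
Lemma member_near p r e x w eps : member p r e x -> enorm (x - p) < r / 2 ->
  (forall y, enorm (y - x) < eps -> Om y) -> enorm w < eps -> member p r e (x + w).
Proof.
move=> mx xp epsOm weps; apply: (member_transport mx); apply: connected_component_segment => t.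
move=> /andP[t0 t1]; rewrite addrAC subrr add0r.
have tw : enorm (t *: w) <= enorm w by rewrite enormZ ger0_norm// ler_piMl// enorm_ge0.
split; first by apply: epsOm; rewrite addrAC subrr add0r (le_lt_trans tw).
have [bp [r0 _] _ _ _] := mx.
have wr : enorm (t *: w) < r / 2.
  apply: le_lt_trans tw _; apply: lt_trans weps _; apply: le_lt_trans xp.
  exact: le_trans (rho_ge oOm bne epsOm) (rho_le x bp).
rewrite /eball/= addrAC enorm_lt//.
have r20 : 0 < r / 2 by rewrite divr_gt0.
move: xp wr; rewrite !enorm_lt// => xp wr.
(* The inequality |u + z|^2 <= 2 (|u|^2 + |z|^2) takes the place of the triangle inequality. *)
have := dotv_sqrD_le (x - p) (t *: w).
have -> : r ^+ 2 = 2 * (r / 2) ^+ 2 + 2 * (r / 2) ^+ 2 by field.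
lra.
Qed.

(** Every competitor at [x] can be replaced by a lower one that still competes at all the points x +
    hv and x - hv. There it dominates [phi], and its own second differences have nonpositive sum;
    the infimum over competitors follows. *)
Lemma phi_second_differences (vs : seq V) x h eps : Om x -> barriers_at x !=set0 ->
  (forall e : V, enorm e = 1 -> \sum_(v <- vs) (dotv v v - K * dotv v e ^+ 2) <= 0) ->
  (forall y, enorm (y - x) < eps -> Om y) -> (forall v, v \in vs -> enorm (h *: v) < eps) ->
  \sum_(v <- vs) (phi (x + h *: v) + phi (x - h *: v) - 2 * phi x) <= 0.
Proof.
move=> Ox ne Hvs epsOm heps.
pose n := (size vs)%:R : R.
pose S := \sum_(v <- vs) (phi (x + h *: v) + phi (x - h *: v)).
have SE : \sum_(v <- vs) (phi (x + h *: v) + phi (x - h *: v) - 2 * phi x) = S - 2 * n * phi x.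
  rewrite big_split/= -/S; congr (_ + _); rewrite sumrN; congr (- _).
  by rewrite big_const_seq count_predT iter_addr_0 /n -mulr_natr; ring.
have key b : barriers_at x b -> S <= 2 * n * b.
  move=> [p [r [e [mx ->]]]].
  have [r' [e' [mx' xp bb]]] := inner_member mx.
  have n0 : 0 <= 2 * n by rewrite mulr_ge0// ler0n.
  apply: le_trans (ler_wpM2l n0 bb); have [_ [r0 _] e1 _ _] := mx'.
  have w0 := weight_gt0 r0.
  apply: (@le_trans _ _ (\sum_(v <- vs) (barrier p r' e' (x + h *: v) + barrier p r' e' (x - h *: v)))).
    rewrite /S big_seq [leRHS]big_seq; apply: ler_sum => v vvs.
    apply: lerD; apply: phi_le_barrier; apply: (member_near mx' xp epsOm); rewrite ?enormN heps//.
  have -> : \sum_(v <- vs) (barrier p r' e' (x + h *: v) + barrier p r' e' (x - h *: v)) =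
    2 * n * barrier p r' e' x +
    weight r' * (2 / r' ^+ 2) * h ^+ 2 * \sum_(v <- vs) (dotv v v - K * dotv v e' ^+ 2).
    rewrite (_ : 2 * n * barrier p r' e' x = \sum_(v <- vs) 2 * barrier p r' e' x); last first.
      by rewrite big_const_seq count_predT iter_addr_0 /n -mulr_natr; ring.
    rewrite mulr_sumr -big_split/=; apply: eq_bigr => v _.
    have E1 : x + h *: v - p = x - p + h *: v by rewrite addrAC.
    have E2 : x - h *: v - p = x - p - h *: v by rewrite addrAC.
    have -> : weight r' * (2 / r' ^+ 2) * h ^+ 2 * (dotv v v - K * dotv v e' ^+ 2) =
       weight r' * (2 / r' ^+ 2 * (dotv (h *: v) (h *: v) - K * dotv (h *: v) e' ^+ 2)).
      by rewrite !dotvE; ring.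
    by rewrite -(profile_second_difference K theta r' (x - p) (h *: v) e') /barrier E1 E2; ring.
  rewrite gerDl; apply: mulr_ge0_le0; last exact: Hvs.
  by rewrite mulr_ge0 ?sqr_ge0// mulr_ge0 ?(ltW w0)// divr_ge0// sqr_ge0.
rewrite SE subr_le0.
(* The empty list is separate because the number of terms is divided out next. *)
case: (vs =P [::]) => [vs0|/eqP vsn].
  by rewrite /S /n vs0 big_nil/= mulr0 mul0r.
have n0 : 0 < 2 * n by rewrite mulr_gt0// ltr0n lt0n size_eq0.
rewrite -ler_pdivrMl//; apply: lb_le_inf => // b /key.
by rewrite ler_pdivrMl.
Qed.

(** A competitor with value below [a] at [x] is continuous and still competes at nearby points. *)
Lemma phi_usc a : (forall x, Om x -> barriers_at x !=set0) -> open [set x | Om x /\ phi x < a].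
Proof.
move=> ne; rewrite openE => x [Ox /(inf_lt (ne _ Ox))[_ [p [r [e [mx ->]]]] ba]].
have [_ _ _ xW _] := mx.
have oW : open (Om `&` eball p r) by apply: openI => //; exact: open_eball.
have [eps eps0 epsW] := open_rowP oW xW.
have cb : continuous (barrier p r e).
  have cc (c : R) : continuous (fun _ : V => c) by exact: cst_continuous.
  move=> y; exact: (continuousM (cc (weight r) y)
    (continuousD (@profile_continuous R d K theta r e p y) (cc theta y))).
have nb : nbhs x [set y | barrier p r e y < a].
  have : open (barrier p r e @^-1` [set t | t < a]).
    by apply: open_comp; [move=> y _; exact: cb|exact: open_lt].
  by move=> ob; apply: open_nbhs_nbhs.
have nx := nbhsx_ballx x eps eps0.
apply: filterS (filterI nb nx) => y [/= yb xy].
have xy' : connected_component (Om `&` eball p r) x y.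
  apply: connected_component_segment => t /andP[t0 t1]; apply: epsW => i.
  have := xy.2 ord0 i; rewrite /ball/= !mxE => xyi.
  have -> : x ord0 i - (x ord0 i + t * (y ord0 i - x ord0 i)) = t * (x ord0 i - y ord0 i) by ring.
  by apply: le_lt_trans xyi; rewrite normrM ger0_norm// ler_piMl.
have my := member_transport mx xy'.
split; first by have [_ _ _ []] := my.
exact: le_lt_trans (phi_le_barrier my) yb.
Qed.

(** Twice the distance to the boundary is used if admissible. Otherwise it exceeds [R0], and [Rinf]
    is larger by a factor of at most Rinf / R0. *)
Lemma exists_scale x : Om x -> exists p r e,
  [/\ member p r e x & r <= Num.max 2 (2 * (Rinf / R0)) * rho Om x].
Proof.
move=> Ox; have rho0 := rho_gt0 oOm bne Ox.
set m := Num.max _ _.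
have m2 : 2 <= m by rewrite le_max lexx.
have main r : admissible r -> 2 * rho Om x <= r -> r <= m * rho Om x ->
    exists p r e, [/\ member p r e x & r <= m * rho Om x].
  move=> ar r2 rm; have [|p bp xp] := @rho_adherent _ _ Om x r bne; first by lra.
  by have [|e mx] := @exists_member p r x ar bp; [split|exists p, r, e].
have two0 : 0 < 2 * rho Om x by rewrite mulr_gt0.
have [le0|gt0] := leP (2 * rho Om x) R0.
  by apply: (main (2 * rho Om x)); [split=> //; left|exact: lexx|rewrite ler_pM2r].
have [leI|gtI] := leP Rinf (2 * rho Om x).
  by apply: (main (2 * rho Om x)); [split=> //; right|exact: lexx|rewrite ler_pM2r].
apply: (main Rinf); [|exact: ltW|].
  by split; [exact: lt_le_trans R0Rinf|right].
apply: (@le_trans _ _ (2 * (Rinf / R0) * rho Om x)); last by rewrite ler_pM2r// le_max lexx orbT.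
have Rinf0 : 0 < Rinf by exact: lt_le_trans R0Rinf.
have -> : 2 * (Rinf / R0) * rho Om x = Rinf * (2 * rho Om x / R0) by ring.
by rewrite ler_peMr ?(ltW Rinf0)// ler_pdivlMr// mul1r ltW.
Qed.

Lemma barriers_nonempty x : Om x -> barriers_at x !=set0.
Proof. by move=> /exists_scale[p [r [e [mx _]]]]; exists (barrier p r e x), p, r, e. Qed.

Lemma phi_ge x : Om x -> theta * rho Om x `^ mu <= phi x.
Proof.
move=> Ox; apply: lb_le_inf; first exact: barriers_nonempty.
by move=> _ [p [r [e [mx ->]]]]; exact: barrier_lower.
Qed.

Lemma phi_le x : Om x ->
  phi x <= (4 * K + 2) * Lam * Num.max 2 (2 * (Rinf / R0)) `^ mu * rho Om x `^ mu.
Proof.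
move=> Ox; have rho0 := rho_gt0 oOm bne Ox.
have [p [r [e [mx rm]]]] := exists_scale Ox.
have [_ [r0 _] _ _ _] := mx.
apply: le_trans (phi_le_barrier mx) _.
have x1 : enorm (x - p) <= 1 * r by rewrite mul1r ltW// (member_enorm mx).
apply: le_trans (barrier_le mx x1) _.
have A : 2 * K * (theta + 1) + 1 ^+ 2 + theta <= 4 * K + 2.
  have := theta_le; have := K0; nra.
apply: le_trans (ler_wpM2l (ltW (weight_gt0 r0)) A) _.
have /andP[_ wr] := weight_bounds (ltW r0).
have K2 : 0 <= 4 * K + 2 by have := K0; lra.
rewrite mulrC -!mulrA ler_wpM2l//; apply: le_trans wr _.
rewrite ler_wpM2l ?(le_trans ler01)//.
rewrite -powRM ?(ltW rho0)//; last by rewrite le_max ler0n.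
apply: ge0_ler_powR rm; rewrite ?nnegrE ?ltW//.
by rewrite mulr_gt0// lt_max ltr0n.
Qed.

End Construction.

(** * The theorem *)

Section EllipticMatrices.
Variables (R : realType) (d : nat).
Local Notation V := 'rV[R]_d.

(** The squared lengths sum to the trace, at most d because each diagonal entry is at most 1; the
    squared products with [e] sum to the form at [e], at least [nu2]. *)
Lemma elliptic_trace_bound (nu2 : R) (A : 'M[R]_d) (vs : seq V) (e : V) :
  0 < nu2 -> in_M nu2 1 A -> (forall i j, A i j = \sum_(v <- vs) v ord0 i * v ord0 j) ->
  enorm e = 1 -> \sum_(v <- vs) (dotv v v - d%:R / nu2 * dotv v e ^+ 2) <= 0.
Proof.
move=> nu0 [symA ellA] AE e1.
have qe : \sum_(v <- vs) dotv v e ^+ 2 = qform A e.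
  transitivity (\sum_(v <- vs) \sum_i \sum_j v ord0 i * v ord0 j * e ord0 i * e ord0 j).
    apply: eq_bigr => v _; rewrite expr2 {1}/dotv mulr_suml; apply: eq_bigr => i _.
    by rewrite /dotv mulr_sumr; apply: eq_bigr => j _; ring.
  rewrite exchange_big; apply: eq_bigr => i _; rewrite exchange_big; apply: eq_bigr => j _.
  by rewrite AE !mulr_suml.
have tr : \sum_(v <- vs) dotv v v <= d%:R.
  rewrite exchange_big/= -[d in d%:R]card_ord -sum1_card natr_sum; apply: ler_sum => i _.
  rewrite -AE -qform_ebase; have /andP[_] := ellA (ebase R i).
  by rewrite mul1r -sqr_enorm enorm_ebase expr1n.
have qe1 : nu2 <= qform A e.
  by have /andP[+ _] := ellA e; rewrite -sqr_enorm e1 expr1n mulr1.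
rewrite big_split/= sumrN -mulr_sumr qe subr_le0; apply: le_trans tr _.
by rewrite -mulrA ler_peMr// mulrC ler_pdivlMr// mul1r.
Qed.

Lemma delta_Om_exterior (Om : set V) (theta r : R) : (0 < d)%N -> 0 < r -> delta_Om Om r < theta ->
  forall p x, bdry Om p -> (Om `&` eball p r) x ->
  exists e : V, enorm e = 1 /\
    forall y, connected_component (Om `&` eball p r) x y -> dotv (y - p) e < theta * r.
Proof.
move=> d0 r0 /inf_lt[|delta [_ [_ ERd]] dt p x bp xr].
  (* An infimum below [theta] yields a witness only for a nonempty set: 1 belongs to it, with any
     unit vector as direction. *)
  exists 1; split; [by rewrite ler01 lexx|split=> // p bp x xr].
  exists (ebase R (Ordinal d0)); split=> [|y /connected_component_sub[_ yr]].
    exact: enorm_ebase.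
  split=> //; rewrite mul1r; apply: le_lt_trans yr; apply: le_trans (ler_norm _) _.
  by apply: dotv_unit_norm; exact: enorm_ebase.
have [e [e1 He]] := ERd p bp x xr; exists e; split=> // y /He[_ /lt_trans]; apply.
by rewrite ltr_pM2r.
Qed.

End EllipticMatrices.

(** With y = 4 (4K+2), the choice theta = y^(-1/eps) makes theta^eps = 1/y. It is at most 1/8
    because y is at least 8 and 1/eps exceeds 1. *)
Lemma opening_small (R : realType) (K eps : R) : 0 < K -> 0 < eps < 1 ->
  exists theta : R, [/\ 0 < theta, theta <= 8^-1 &
    theta^-1 `^ (1 - eps) * ((4 * K + 2) * theta) <= 4^-1].
Proof.
move=> K0 /andP[eps0 eps1].
pose y := 4 * (4 * K + 2); have y8 : 8 <= y by rewrite /y; lra.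
pose T := y `^ eps^-1; have T0 : 0 < T by apply: powR_gt0; lra.
exists T^-1; split; first by rewrite invr_gt0.
  rewrite lef_pV2 ?posrE//; apply: le_trans y8 _; rewrite -[leLHS]powRr1; last by rewrite /y; lra.
  by apply: ler_powR; [rewrite /y; lra|rewrite invf_ge1// ltW].
rewrite invrK; have Te : T `^ eps = y.
  by rewrite /T -powRrM mulVf ?gt_eqF// powRr1//; lra.
have TE : T = T `^ (1 - eps) * y.
  rewrite -{1}Te -powRD; last by rewrite subrK oner_eq0.
  by rewrite subrK powRr1// ltW.
have Tm : 0 < T `^ (1 - eps) by exact: powR_gt0.
have -> : T^-1 = (T `^ (1 - eps) * y)^-1 by rewrite -TE.
rewrite (_ : _ * _ = 4^-1)// /y; field.
by apply/andP; split; rewrite gt_eqF//; lra.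
Qed.

(** The order of the quantifiers expresses the dependence of the constants: [delta1] precedes the
    domain, and [N] depends on the domain only through the ratio [kappa]. *)
Theorem theorem5p19 (R : realType) (d : nat) : (2 <= d)%N ->
  forall nu eps : R, 0 < nu <= 1 -> 0 < eps < 1 ->
  exists delta1 : R, 0 < delta1 /\
  forall kappa : R, 0 < kappa <= 1 ->
  exists N : R, 0 < N /\
  forall (Om : set 'rV[R]_d) (R0 Rinf : R),
    is_domain Om -> Om != setT ->
    R0 / Rinf = kappa ->
    TER_with Om delta1 R0 Rinf ->
    exists phi : 'rV[R]_d -> R,
      measurable_on Om phi /\
      (forall A : 'M[R]_d, in_M (nu ^+ 2) 1 A -> distr_nonpos Om A phi) /\
      (forall x, Om x ->
         N^-1 * (rho Om x `^ (1 - eps)) <= phi x <= N * (rho Om x `^ (1 - eps))).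
Proof.
move=> d2 nu eps /andP[nu0 nu1] epsb; have d0 : (0 < d)%N by exact: leq_trans d2.
have [eps0 eps1] := andP epsb.
have nu20 : 0 < nu ^+ 2 by rewrite exprn_gt0.
pose K : R := d%:R / nu ^+ 2.
have K0 : 0 < K by rewrite divr_gt0// ltr0n.
have [theta [theta0 theta8 theta_small]] := opening_small K0 epsb.
(* Half of [theta] makes the infimum [delta_Om] strictly smaller than [theta], since it need not be
   attained. *)
exists (theta / 2); split; first by rewrite divr_gt0.
move=> kappa /andP[kappa0 kappa1].
set mu := 1 - eps in theta_small *; have mu0 : 0 < mu by rewrite subr_gt0.
(* Exactly (Rinf / R0)^mu, the factor that bridges the gap between the two scales. *)
pose Lam := kappa^-1 `^ mu.
have Lam1 : 1 <= Lam.
  by rewrite /Lam -[leLHS](powRr0 kappa^-1); apply: ler_powR; [rewrite invf_ge1|exact: ltW].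
pose C := (4 * K + 2) * Lam * Num.max 2 (2 * kappa^-1) `^ mu.
have C0 : 0 <= C.
  by rewrite mulr_ge0 ?powR_ge0// mulr_ge0 ?(le_trans ler01)//; lra.
(* The sum serves both bounds: [theta] from below and [C] from above. *)
have N0 : 0 < theta^-1 + C by rewrite ltr_pwDl// invr_gt0.
exists (theta^-1 + C); split=> // Om R0 Rinf [oOm [_ Omne]] OmT kappaE [R00 [R0Rinf TER]].
have Rinf0 : 0 < Rinf by exact: lt_le_trans R0Rinf.
have bne := bdry_nonempty oOm Omne OmT.
have kappaV : Rinf / R0 = kappa^-1 by rewrite -kappaE invf_div.
have gap : Rinf `^ mu <= Lam * R0 `^ mu.
  rewrite /Lam -powRM ?invr_ge0 ?(ltW kappa0) ?(ltW R00)// -kappaV divfK// gt_eqF//.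
have ext r p x : admissible R0 Rinf r -> bdry Om p -> (Om `&` eball p r) x ->
    exists e : 'rV[R]_d, enorm e = 1 /\
    forall y, connected_component (Om `&` eball p r) x y -> dotv (y - p) e < theta * r.
  move=> [r0 ar]; apply: delta_Om_exterior => //; apply: le_lt_trans (TER r r0 ar) _.
  by rewrite ltr_pdivrMr// ltr_pMr// ltr1n.
pose f := phi K theta mu Lam R0 Rinf Om.
have f_ge x : Om x -> theta * rho Om x `^ mu <= f x by exact: phi_ge.
have f_le x : Om x -> f x <= C * rho Om x `^ mu.
  by rewrite /C -kappaV; apply: phi_le.
have mf : measurable_on Om f.
  by apply: measurable_on_usc => a; apply: phi_usc => // x; exact: barriers_nonempty.
exists f; split=> //; split=> [A MA|x Ox]; last first.
  have rm := powR_ge0 (rho Om x) mu.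
  apply/andP; split.
    apply: le_trans (f_ge _ Ox); rewrite ler_wpM2r// -[leRHS]invrK lef_pV2 ?posrE ?invr_gt0//.
    by rewrite lerDl.
  by apply: le_trans (f_le _ Ox) _; rewrite ler_wpM2r// lerDr invr_ge0 ltW.
have [symA ellA] := MA.
have [|vs AE] := psd_sum_rank1 symA.
  by move=> x; have /andP[+ _] := ellA x; apply: le_trans; rewrite mulr_ge0 ?dotv_ge0 ?ltW.
pose P x := if x \in Om then f x else 0.
apply: (distr_nonpos_of_second_differences (P := P) AE) => //.
- have -> : P \o @rV_of_tuple R d = (f \o @rV_of_tuple R d) \_ (@rV_of_tuple R d @^-1` Om).
    by apply/funext => t; rewrite patchE.
  exact: (measurable_restrictT _ (measurable_open_preimage oOm)).1 mf.
- have [p0 bp0] := bne.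
  (* The distance to the boundary is at most that to a fixed boundary point [p0], which is bounded
     on bounded sets. *)
  move=> M; exists (C * (`|M| + norm1 p0) `^ mu) => x xM; rewrite /P.
  case: ifPn => [/set_mem Ox|_]; last by rewrite normr0 mulr_ge0// powR_ge0.
  rewrite ger0_norm; last by apply: le_trans (f_ge _ Ox); rewrite mulr_ge0 ?powR_ge0 ?ltW.
  apply: le_trans (f_le _ Ox) _; rewrite ler_wpM2l//.
  have rx : rho Om x <= `|M| + norm1 p0.
    apply: le_trans (rho_le x bp0) _; apply: le_trans (enorm_norm1 _) _.
    by apply: le_trans (norm1D _ _) _; rewrite norm1N lerD2r (le_trans xM)// ler_norm.
  apply: ge0_ler_powR rx; rewrite ?nnegrE ?(ltW mu0)//; first exact/ltW/rho_gt0.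
  by rewrite addr_ge0// norm1_ge0.
- move=> Q cQ QOm; have [e e0 He] := compact_uniform_interior oOm cQ QOm.
  (* Dividing by 1 + s keeps every step h v shorter than [e], so all the points used lie in [Om],
     where [P] equals [f]. *)
  pose s := \sum_(v <- vs) enorm v.
  have s0 : 0 <= s by apply: sumr_ge0 => v _; exact: enorm_ge0.
  have s1 : 0 < 1 + s by rewrite ltr_wpDr.
  exists (e / (1 + s)); first by rewrite divr_gt0.
  move=> x h Qx /andP[h0 hh].
  have hv v : v \in vs -> enorm (h *: v) < e.
    move=> vvs; rewrite enormZ gtr0_norm//.
    have vs1 : enorm v <= s by rewrite /s (big_rem v)//= lerDl sumr_ge0// => u _; exact: enorm_ge0.
    have : h * (1 + s) <= e by rewrite -ler_pdivlMr.
    apply: lt_le_trans; rewrite ltr_pM2l//; lra.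
  have Ox := QOm _ Qx.
  rewrite big_seq (eq_bigr (fun v => f (x + h *: v) + f (x - h *: v) - 2 * f x)); last first.
    move=> v vvs; rewrite /P !mem_set//; apply: (He x) => //; rewrite addrAC subrr add0r ?enormN;
    exact: hv.
  rewrite -big_seq.
  apply: (phi_second_differences K0 theta0 theta8 mu0 Lam1 R00 R0Rinf theta_small gap oOm bne
    ext Ox _ _ (fun y => He x y Qx) hv); first exact: barriers_nonempty.
  by move=> u u1; exact: elliptic_trace_bound MA AE u1.
Qed.
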